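(* Let $\mathbb{A}$ be a finite-dimensional real division algebra (with identity, power-associative), and let $P(x) \in \mathbb{R}[x]$. For any non-central root $\alpha \in \mathbb{A} \setminus Z(\mathbb{A})$ of $P$, the solution set $Z(P) = \{x \in \mathbb{A} : P(x) = 0\}$ contains a submanifold diffeomorphic to the homogeneous space $G/H$, where $G = \operatorname{Aut}(\mathbb{A})$ and $H = \operatorname{Stab}_G(\alpha) = \{g \in G : g(\alpha) = \alpha\}$.
   Context: $Z(\mathbb{A})$ denotes the center of $\mathbb{A}$ (not to be confused with the zero set $Z(P)$). $\operatorname{Aut}(\mathbb{A})$ is the group of all bijective $\mathbb{R}$-linear maps $g : \mathbb{A} \to \mathbb{A}$ with $g(xy) = g(x)g(y)$ for all $x, y$. A polynomial $P = \sum_k a_k x^k$ with $a_k \in \mathbb{R}$ is evaluated at $x \in \mathbb{A}$ as $P(x) = \sum_k a_k x^k$, where powers are well defined by power-associativity. Associativity of $\mathbb{A}$ is not assumed. *)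

(* Defs.v *)
From mathcomp Require Import all_boot all_order all_algebra.
From mathcomp Require Import all_classical all_reals all_analysis.
Set Implicit Arguments.
Unset Strict Implicit.
Unset Printing Implicit Defensive.

Import Order.TTheory GRing.Theory Num.Theory.
Import numFieldNormedType.Exports passmx.

Local Open Scope classical_set_scope.
Local Open Scope ring_scope.

(* Non-associative algebras: the product is a bare bilinear map on a
   finite-dimensional real vector space. *)
Section Algebra.
Variables (R : realType) (A : vectType R).
Variables (mul : {bilinear A -> A -> A}) (one : A).

Definition is_unit_element := forall x : A, mul one x = x /\ mul x one = x.

Definition is_division_algebra :=
  [/\ is_unit_element, one != 0 &
      forall a : A, a != 0 ->
        bijective (fun x => mul a x) /\ bijective (fun x => mul x a)].

Definition mul_closed (S : {vspace A}) :=
  forall x y, x \in S -> y \in S -> mul x y \in S.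

Definition generated_subalgebra (x : A) : set A :=
  [set y | forall S : {vspace A}, mul_closed S -> x \in S -> y \in S].

Definition power_associative := forall x u v w : A,
  generated_subalgebra x u -> generated_subalgebra x v ->
  generated_subalgebra x w -> mul u (mul v w) = mul (mul u v) w.

(* In a non-associative algebra, a central element is required to associate,
   and not only to commute, with all elements. *)
Definition algebra_center : set A :=
  [set z | forall x y,
    [/\ mul z x = mul x z,
        mul (mul z x) y = mul z (mul x y),
        mul (mul x z) y = mul x (mul z y) &
        mul (mul x y) z = mul x (mul y z)]].

Definition power (x : A) (k : nat) : A := iter k (fun y => mul x y) one.

Definition eval_poly (P : {poly R}) (x : A) : A :=
  \sum_(k < size P) P`_k *: power x k.

Definition zero_set (P : {poly R}) : set A := [set x | eval_poly P x = 0].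

Definition automorphisms : set 'End(A) :=
  [set g : 'End(A) | bijective g /\ forall x y, g (mul x y) = mul (g x) (g y)].

Definition stabilizer (a : A) : set 'End(A) :=
  [set g | automorphisms g /\ g a = a].

End Algebra.

(* Topology and differential calculus on a finite-dimensional real vector space
   V, read in the coordinates of a basis of V; linear changes of coordinates
   being diffeomorphisms, the choice of the basis is immaterial. *)
Section Smooth.
Variable R : realType.

Definition to_coords (V : vectType R) : V -> 'rV[R]_(\dim {:V}) :=
  rVof (vbasis {:V}).

Definition of_coords (V : vectType R) : 'rV[R]_(\dim {:V}) -> V :=
  vecof (vbasis {:V}).

Definition vopen (V : vectType R) (U : set V) := open (@of_coords V @^-1` U).

Definition iter_derive (m n : nat) (vs : seq 'rV[R]_m)
    (f : 'rV[R]_m -> 'rV[R]_n) : 'rV[R]_m -> 'rV[R]_n :=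
  foldr (fun v g => (fun x => 'D_v g x)) f vs.

(* f is infinitely differentiable on the open set U *)
Definition smooth_on (V W : vectType R) (U : set V) (f : V -> W) :=
  forall vs x, U (of_coords x) ->
    differentiable (iter_derive vs (@to_coords W \o f \o @of_coords V)) x.

(* embedded submanifold, by slice charts phi : U -> U' with inverse psi *)
Definition embedded_submanifold (V : vectType R) (S : set V) :=
  exists2 k : nat, (k <= \dim {:V})%N &
  forall p, S p ->
  exists (U : set V) (U' : set 'rV[R]_(\dim {:V}))
         (phi : V -> 'rV[R]_(\dim {:V})) (psi : 'rV[R]_(\dim {:V}) -> V),
    [/\ [/\ vopen U, U p & vopen U'],
        smooth_on U phi /\ smooth_on U' psi,
        forall x, U x -> U' (phi x) /\ psi (phi x) = x,
        forall y, U' y -> U (psi y) /\ phi (psi y) = y &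
        forall x, U x ->
          (S x <-> forall i : 'I_(\dim {:V}), (k <= i)%N -> phi x 0 i = 0)].

(* Smooth structures as functional structures: a topology together with, for
   each open U, the real functions that are smooth on U.  Functions are total,
   only their values on U matter.  A smooth manifold is determined by this
   datum, and a map is smooth iff it is continuous and pulls smooth functions
   back to smooth functions. *)
Record functional_space := FunctionalSpace {
  space_carrier :> Type;
  opens : set (set space_carrier);
  smooth_fun : set space_carrier -> set (space_carrier -> R) }.

Definition smooth_map (X Y : functional_space) (phi : X -> Y) :=
  forall V, opens V -> opens (phi @^-1` V) /\
    forall f, smooth_fun V f -> smooth_fun (phi @^-1` V) (f \o phi).

Definition diffeomorphic (X Y : functional_space) :=
  exists (phi : X -> Y) (psi : Y -> X),
    [/\ cancel phi psi, cancel psi phi, smooth_map phi & smooth_map psi].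

(* Induced structure: smooth functions on a subset S of V are the local
   restrictions of smooth functions on V.  For an embedded submanifold this is
   its usual smooth structure. *)
Definition induced_space (V : vectType R) (S : set V) : functional_space :=
  @FunctionalSpace S
    [set D | exists2 U : set V, vopen U & D = set_val @^-1` U]
    (fun D : set S => [set f : S -> R | forall p : S, D p ->
       exists (U : set V) (F : V -> R^o),
         [/\ vopen U, U (set_val p), smooth_on U F &
             forall q : S, D q -> U (set_val q) -> f q = F (set_val q)]]).

(* Quotient structure along pi : X -> Q: quotient topology, and f is smooth
   iff f \o pi is. *)
Definition quotient_space (X : functional_space) (Q : Type) (pi : X -> Q) :
    functional_space :=
  @FunctionalSpace Q
    [set U | opens (pi @^-1` U)]
    (fun U : set Q => [set f : Q -> R | smooth_fun (pi @^-1` U) (f \o pi)]).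

Section Homogeneous.
Variables (V : vectType R) (G H : set 'End(V)).

Definition left_coset (g : 'End(V)) : set 'End(V) := [set (g \o h)%VF | h in H].

Definition cosets : set (set 'End(V)) := [set left_coset g | g in G].

Definition coset_proj (g : G) : cosets :=
  SigSub (mem_set (ex_intro2 _ _ (set_val g) (set_valP g) erefl)).

(* For G a closed subgroup of GL(V), which is then a Lie group embedded in
   End(V), and H a closed subgroup of G, this is the smooth structure of the
   homogeneous space G/H: the unique one for which the projection G -> G/H is a
   smooth submersion. *)
Definition homogeneous_space : functional_space :=
  @quotient_space (induced_space G) cosets coset_proj.

End Homogeneous.
End Smooth.

(* Main.v *)
Require Import Defs.
From HB Require Import structures.
From mathcomp Require Import all_boot all_order all_algebra.
From mathcomp Require Import all_classical all_reals all_analysis.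
From mathcomp Require Import ring lra.

(* Let M be the orbit of alpha under G = Aut(A).  Polynomials with real
   coefficients commute with automorphisms, so M consists of roots of P.  Since
   c |x|^2 <= |x x| for some c > 0, the group G is bounded, hence compact; its
   Lie algebra consists of derivations, and the exponential of a derivation is
   an automorphism.  If D_1, ..., D_k are derivations such that the D_i alpha
   form a basis of the tangent space T = Der(A) alpha, and N is a complement of
   T, then (t, y) |-> exp(t_1 D_1) ... exp(t_k D_k) (alpha + y), for y in N, is
   a local diffeomorphism.  A small alpha + y, with y in N, lies in M only if
   y = 0: this makes the inverse a slice chart of M, and the product of
   exponentials a smooth local section of g |-> g alpha.  The latter shows that
   G/H -> M is a diffeomorphism. *)

Set Implicit Arguments.
Unset Strict Implicit.
Unset Printing Implicit Defensive.
Import Order.TTheory GRing.Theory Num.Theory.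
Import numFieldNormedType.Exports.
Local Open Scope classical_set_scope.
Local Open Scope ring_scope.

(** * Smooth real functions *)

(** The delicate point is not local: an automorphism that moves [alpha] only slightly may be far
    from the identity, so the orbit could return near [alpha] outside the piece swept by the
    exponentials. Boundedness excludes this: correcting by the stabilizer brings such an
    automorphism as near to the identity as possible, and limits exist. The constant c comes from
    division: only 0 has square 0. Automorphisms preserve squares, so a quadratic lower bound meets
    a linear upper bound on their norm. No charts on G are built: G carries the structure induced
    from End(A), so a local section only has to be smooth into End(A). A product of exponentials is
    preferred to the exponential of a sum because it needs only derivatives of curves t |-> exp(t
    D). The analysis takes place on row vectors, with matrices acting on the right: [g *m h] applies
    [g] first. *)

Section Differentiability.
Variables (R : realType) (V W : normedModType R).
Implicit Types f g : V -> W.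

Lemma differentiable_epsP f (L : {linear V -> W}) x : continuous L ->
  (forall e, 0 < e -> \forall h \near (0 : V),
     `|f (h + x) - f x - L h| <= e * `|h|) ->
  differentiable f x /\ 'd f x = L :> (V -> W).
Proof.
move=> Lc fL.
have fo : f \o shift x = cst (f x) + L +o_ (0 : V) id.
  apply/eqaddoP => e e0; near=> h.
  rewrite /= !fctE /= opprD addrA; near: h; exact: fL.
have dfE : 'd f x = L :> (V -> W) by exact: diff_unique.
by split=> //; apply/diff_locallyP; rewrite dfE.
Unshelve. all: by end_near. Qed.

Lemma differentiable_eps f x : differentiable f x ->
  forall e, 0 < e -> \forall h \near (0 : V),
     `|f (h + x) - f x - 'd f x h| <= e * `|h|.
Proof.
move=> /diff_locallyP[_ /eqaddoP fo] e e0.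
have := fo e e0; apply: filterS => h /=.
by rewrite !fctE /= opprD addrA.
Qed.

Lemma near_translate (P : set V) x : (\forall y \near x, P y) ->
  \forall h \near (0 : V), P (h + x).
Proof.
move=> Px; have : (fun h : V => h + x) @ (0 : V) --> (0 + x).
  by apply: cvgD; [exact: cvg_id|exact: cvg_cst].
by rewrite add0r => /(_ _ Px).
Qed.

Lemma near_eq_differentiable f g x : {near x, f =1 g} ->
  differentiable f x -> differentiable g x.
Proof.
move=> fg df; apply: (proj1 (@differentiable_epsP g ('d f x) x _ _)).
  exact: diff_continuous.
move=> e e0; have gf := nbhs_singleton fg.
have fg0 := near_translate fg.
near=> h.
rewrite -gf -(near fg0 h) //; near: h; exact: differentiable_eps.
Unshelve. all: by end_near. Qed.

End Differentiability.

(** * Smoothness through algebras of functions stable under differentiation *)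

Section Smooth.
Variables (R : realType) (m : nat).
Implicit Types (O : set 'rV[R]_m) (f g : 'rV[R]_m -> R).

Definition iter_derivative (vs : seq 'rV[R]_m) f : 'rV[R]_m -> R :=
  foldr (fun v g => (fun x => 'D_v g x)) f vs.

Definition smooth O f :=
  forall vs x, O x -> differentiable (iter_derivative vs f) x.

Inductive generated O (B : set ('rV[R]_m -> R)) : ('rV[R]_m -> R) -> Prop :=
| generated_cst c : generated O B (cst c)
| generated_base b : B b -> generated O B b
| generatedD f g : generated O B f -> generated O B g ->
    generated O B (fun x => f x + g x)
| generatedM f g : generated O B f -> generated O B g ->
    generated O B (fun x => f x * g x)
| generated_eq f g : (forall x, O x -> f x = g x) -> generated O B f ->
    generated O B g.

Lemma generated_sum O B (I : Type) (r : seq I) (F : I -> 'rV[R]_m -> R) :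
  (forall i, generated O B (F i)) ->
  generated O B (fun x => \sum_(i <- r) F i x).
Proof.
move=> BF; elim: r => [|i r IH].
  by apply: (generated_eq _ (generated_cst O B 0)) => x _; rewrite big_nil.
by apply: (generated_eq _ (generatedD (BF i) IH)) => x _; rewrite big_cons.
Qed.

Lemma open_near_eq O f g x : open O -> O x ->
  (forall y, O y -> f y = g y) -> {near x, f =1 g}.
Proof.
move=> Oo Ox fg; near=> y; apply: fg; near: y; exact: open_nbhs_nbhs.
Unshelve. all: by end_near. Qed.

(** By the Leibniz rule, an algebra whose generators have their derivatives in it is stable under
    every ['D_v]. All iterated derivatives stay inside, where everything is differentiable, and no
    formula for higher derivatives is ever written. *)
Lemma smooth_generated O B : open O ->
  (forall b x, B b -> O x -> differentiable b x) ->
  (forall b v, B b -> generated O B ('D_v b)) ->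
  forall f, generated O B f -> smooth O f.
Proof.
move=> Oo dB DB.
have dG f : generated O B f -> forall x, O x -> differentiable f x.
  elim=> {f} [c|b Bb|f g _ df _ dg|f g _ df _ dg|f g fg _ df] x Ox.
  - exact: differentiable_cst.
  - exact: dB.
  - exact: (differentiableD (df x Ox) (dg x Ox)).
  - exact: (differentiableM (df x Ox) (dg x Ox)).
  - exact: near_eq_differentiable (open_near_eq Oo Ox fg) (df x Ox).
have DG f v : generated O B f -> generated O B ('D_v f).
  elim=> {f} [c|b Bb|f g Bf Df Bg Dg|f g Bf Df Bg Dg|f g fg Bf Df].
  - by apply: (generated_eq _ (generated_cst O B 0)) => x _; rewrite derive_cst.
  - exact: DB.
  - apply: (generated_eq _ (generatedD Df Dg)) => x Ox.
    by rewrite (deriveD (diff_derivable (dG _ Bf _ Ox))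
      (diff_derivable (dG _ Bg _ Ox))).
  - apply: (generated_eq _ (generatedD (generatedM Bf Dg) (generatedM Bg Df))).
    move=> x Ox.
    by rewrite (deriveM (diff_derivable (dG _ Bf _ Ox))
      (diff_derivable (dG _ Bg _ Ox))).
  - apply: (generated_eq _ Df) => x Ox.
    exact: near_eq_derive (open_near_eq Oo Ox fg).
move=> f Bf vs; apply: dG; elim: vs => //= v vs IH; exact: DG.
Qed.

Lemma iter_derivative_cat vs ws f :
  iter_derivative (vs ++ ws) f = iter_derivative vs (iter_derivative ws f).
Proof. by rewrite /iter_derivative foldr_cat. Qed.

Lemma smooth_differentiable O f x : smooth O f -> O x -> differentiable f x.
Proof. by move=> sf; exact: (sf [::]). Qed.

Lemma smooth_derive O f v : smooth O f -> smooth O ('D_v f).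
Proof.
move=> sf vs x Ox; have := sf (vs ++ [:: v]) x Ox.
by rewrite iter_derivative_cat.
Qed.

Lemma sub_smooth O O' f : O' `<=` O -> smooth O f -> smooth O' f.
Proof. by move=> O'O sf vs x /O'O; exact: sf. Qed.

Lemma smooth_closed O f : open O -> generated O (smooth O) f -> smooth O f.
Proof.
move=> Oo; apply: smooth_generated => // [b x sb Ox|b v sb].
  exact: smooth_differentiable sb Ox.
exact/generated_base/smooth_derive.
Qed.

Lemma smooth_eq O f g : open O -> (forall x, O x -> f x = g x) ->
  smooth O f -> smooth O g.
Proof.
move=> Oo fg sf; apply: smooth_closed => //.
exact: generated_eq fg (generated_base _ sf).
Qed.

Lemma smooth_cst O c : open O -> smooth O (cst c).
Proof. by move=> Oo; apply: smooth_closed => //; exact: generated_cst. Qed.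

Lemma smoothD O f g : open O -> smooth O f -> smooth O g ->
  smooth O (fun x => f x + g x).
Proof.
by move=> Oo sf sg; apply: smooth_closed => //; apply: generatedD;
  exact: generated_base.
Qed.

Lemma smoothM O f g : open O -> smooth O f -> smooth O g ->
  smooth O (fun x => f x * g x).
Proof.
by move=> Oo sf sg; apply: smooth_closed => //; apply: generatedM;
  exact: generated_base.
Qed.

Lemma smooth_sum O (I : Type) (r : seq I) (F : I -> 'rV[R]_m -> R) : open O ->
  (forall i, smooth O (F i)) -> smooth O (fun x => \sum_(i <- r) F i x).
Proof.
move=> Oo sF; apply: smooth_closed => //; apply: generated_sum => i.
exact: generated_base.
Qed.

Lemma smooth_prod O (I : Type) (r : seq I) (F : I -> 'rV[R]_m -> R) : open O ->
  (forall i, smooth O (F i)) -> smooth O (fun x => \prod_(i <- r) F i x).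
Proof.
move=> Oo sF; elim: r => [|i r IH].
  apply: (smooth_eq Oo _ (smooth_cst 1 Oo)) => x _; by rewrite big_nil.
by apply: (smooth_eq Oo _ (smoothM Oo (sF i) IH)) => x _; rewrite big_cons.
Qed.

Lemma smooth_coord O j : open O -> smooth O (fun x => x 0 j).
Proof.
move=> Oo; apply: (@smooth_generated O [set (fun x : 'rV[R]_m => x 0 j)]) => //.
- by move=> b x -> _; exact: differentiable_coord.
- move=> b v ->; apply: (generated_eq _ (generated_cst _ _ (v 0 j))) => x _.
  have := @derive_mx R _ 1 m id x v (@derivable_id _ _ x v).
  by move=> /(congr1 (fun M : 'rV[R]_m => M 0 j)); rewrite mxE => <-; rewrite derive_id.
exact: generated_base.
Qed.

(** The inverse of [f] joins the smooth functions as a generator: its derivative, minus its square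
    times ['D_v f], is again a product of generators. *)
Lemma smoothV O f : open O -> (forall x, O x -> f x != 0) -> smooth O f ->
  smooth O (fun x => (f x)^-1).
Proof.
move=> Oo f0 sf.
apply: (@smooth_generated O (smooth O `|` [set fun x => (f x)^-1])) => //.
- move=> b x [sb|->] Ox; first exact: smooth_differentiable sb Ox.
  by apply: differentiableV; [exact: smooth_differentiable sf Ox|exact: f0].
- move=> b v [sb|->].
    by apply: generated_base; left; exact: smooth_derive.
  apply: (@generated_eq _ _ (fun x => cst (-1) x * (((f x)^-1 * (f x)^-1) * 'D_v f x))).
    move=> x Ox; rewrite deriveV ?f0//; last first.
      exact/diff_derivable/(smooth_differentiable sf Ox).
    by rewrite /cst /= -exprVn expr2 mulN1r scaleNr.
  apply: generatedM; first exact: generated_cst.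
  apply: generatedM.
    by apply: generatedM; apply: generated_base; right.
  by apply: generated_base; left; exact: smooth_derive.
by apply: generated_base; right.
Qed.

Lemma smooth_det n O (M : 'rV[R]_m -> 'M[R]_n) : open O ->
  (forall i j, smooth O (fun x => M x i j)) -> smooth O (fun x => \det (M x)).
Proof.
move=> Oo sM; apply: smooth_sum => // s; apply: smoothM => //.
  exact: smooth_cst.
by apply: smooth_prod.
Qed.

(** Cramer's rule: the entries are cofactors over the determinant, which does not vanish on [O]. *)
Lemma smooth_invmx n O (M : 'rV[R]_m -> 'M[R]_n) : open O ->
  (forall x, O x -> M x \in unitmx) ->
  (forall i j, smooth O (fun x => M x i j)) ->
  forall i j, smooth O (fun x => invmx (M x) i j).
Proof.
move=> Oo uM sM i j.
apply: (@smooth_eq _ (fun x => (\det (M x))^-1 * ((-1) ^+ (j + i) *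
    \det (\matrix_(k, l) M x (lift j k) (lift i l))))) => //.
  move=> x Ox; rewrite /invmx (uM _ Ox) !mxE; congr (_ * (_ * \det _)).
  by apply/matrixP => k l; rewrite !mxE.
apply: smoothM => //.
  apply: smoothV => //; last exact: smooth_det.
  by move=> x /uM; rewrite unitmxE unitfE.
apply: smoothM => //; first exact: smooth_cst.
apply: smooth_det => // k l.
by apply: (smooth_eq Oo _ (sM (lift j k) (lift i l))) => x _; rewrite mxE.
Qed.

End Smooth.

(** * Row vectors, the sup norm and directional derivatives *)

Section RowVectors.
Variable R : realType.

Lemma le_coord_norm m n (M : 'M[R]_(m, n)) i j : `|M i j| <= `|M|.
Proof. by rewrite [leRHS]/Num.Def.normr /= mx_normrE (le_bigmax _ _ (i, j)). Qed.

Lemma norm_le_coord m n (M : 'M[R]_(m, n)) c : 0 <= c ->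
  (forall i j, `|M i j| <= c) -> `|M| <= c.
Proof.
by move=> c0 Mc; rewrite [leLHS]/Num.Def.normr /= mx_normrE bigmax_le // => -[i j] _.
Qed.

Lemma norm_mulmx_le m n (v : 'rV[R]_m) (M : 'M[R]_(m, n)) c : 0 <= c ->
  (forall i j, `|M i j| <= c) -> `|v *m M| <= m%:R * c * `|v|.
Proof.
move=> c0 Mc; apply: norm_le_coord => [|i j].
  apply: mulr_ge0 => //; exact: mulr_ge0.
rewrite mxE (le_trans (ler_norm_sum _ _ _)) //.
have -> : m%:R * c * `|v| = \sum_(k < m) `|v| * c.
  by rewrite sumr_const card_ord -mulrA [c * _]mulrC mulr_natl.
apply: ler_sum => k _; rewrite normrM; apply: ler_pM => //; exact: le_coord_norm.
Qed.

Lemma mulmx_continuous m n (M : 'M[R]_(m, n)) :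
  continuous (mulmxr M : 'rV[R]_m -> 'rV[R]_n).
Proof.
pose c := `|M|.
have Mc : forall v : 'rV[R]_m, `|v *m M| <= m%:R * c * `|v|.
  by move=> v; apply: norm_mulmx_le => [|i j]; [exact: normr_ge0|exact: le_coord_norm].
apply: (@bounded_linear_continuous _ _ _ (mulmxr M)).
apply/linear_boundedP; near=> r => v; rewrite (le_trans (Mc v)) //.
by rewrite ler_wpM2r.
Unshelve. all: by end_near. Qed.

Lemma linear_rV_continuous m n (f : {linear 'rV[R]_m -> 'rV[R]_n}) :
  continuous f.
Proof.
rewrite (_ : (f : _ -> _) = mulmxr (lin1_mx f)); first exact: mulmx_continuous.
by apply/funext => v /=; rewrite mul_rV_lin1.
Qed.

Variable V : normedModType R.

Lemma differentiable_rV n (f : V -> 'rV[R]_n) x :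
  (forall j, differentiable (fun y => f y 0 j) x) -> differentiable f x.
Proof.
move=> df.
rewrite (_ : f = \sum_(j < n) (fun y => f y 0 j *: delta_mx 0 j)).
  by apply: differentiable_sum => j; exact: differentiableZl.
by apply/funext => y; rewrite fct_sumE [LHS]row_sum_delta.
Qed.

Lemma differentiable_rV_coord n (f : V -> 'rV[R]_n) x j :
  differentiable f x -> differentiable (fun y => f y 0 j) x.
Proof.
move=> df; apply: (@differentiable_comp _ _ _ _ f (fun v : 'rV[R]_n => v 0 j)) => //.
exact: differentiable_coord.
Qed.

Lemma derive_rV n (f : V -> 'rV[R]_n) x v j : differentiable f x ->
  ('D_v f x) 0 j = 'D_v (fun y => f y 0 j) x.
Proof. by move=> /(@diff_derivable _ _ _ _ _ v)/derive_mx ->; rewrite mxE. Qed.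

Lemma derive_rV_delta n (f : 'rV[R]_n -> V) x v : differentiable f x ->
  'D_v f x = \sum_(i < n) v 0 i *: 'D_(delta_mx 0 i) f x.
Proof.
move=> df; rewrite deriveE // [v in LHS]row_sum_delta linear_sum.
by apply: eq_bigr => i _; rewrite linearZ deriveE.
Qed.

End RowVectors.

Lemma derive_comp (R : realType) (V W : normedModType R) n (g : V -> 'rV[R]_n)
    (f : 'rV[R]_n -> W) x v :
  differentiable g x -> differentiable f (g x) ->
  'D_v (f \o g) x = \sum_(i < n) ('D_v g x) 0 i *: 'D_(delta_mx 0 i) f (g x).
Proof.
move=> dg df; rewrite deriveE; last exact: differentiable_comp.
by rewrite diff_comp //= -(deriveE _ dg) -(deriveE _ df) derive_rV_delta.
Qed.

Section Composition.
Variables (R : realType) (m n : nat).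
Variables (O : set 'rV[R]_m) (W : set 'rV[R]_n) (g : 'rV[R]_m -> 'rV[R]_n).
Hypotheses (Oo : open O) (gOW : forall x, O x -> W (g x)).

(* The derivative of g may be expressed through functions of g itself: this is
   what makes the lemma applicable to inverse functions. *)
Lemma smooth_comp_generated :
  (forall x, O x -> differentiable g x) ->
  (forall v j, generated O (smooth O `|` [set f \o g | f in smooth W])
     (fun x => ('D_v g x) 0 j)) ->
  forall f, smooth W f -> smooth O (f \o g).
Proof.
move=> dg Dg f sf.
set B := _ `|` _ in Dg; apply: (@smooth_generated _ _ O B) => //; last first.
  by apply: generated_base; right; exists f.
- move=> b v [sb|[h sh <-]].
    by apply: generated_base; left; exact: smooth_derive.
  apply: (@generated_eq _ _ _ _
    (fun x => \sum_(i < n) ('D_v g x) 0 i * ('D_(delta_mx 0 i) h \o g) x)).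
    move=> x Ox.
    by rewrite (derive_comp _ (dg _ Ox) (smooth_differentiable sh (gOW Ox))).
  apply: generated_sum => i; apply: generatedM => //.
  by apply: generated_base; right; exists ('D_(delta_mx 0 i) h) => //; exact: smooth_derive.
- move=> b x [sb|[h sh <-]] Ox; first exact: smooth_differentiable sb Ox.
  apply: differentiable_comp; first exact: dg.
  exact: smooth_differentiable sh (gOW Ox).
Qed.

Lemma smooth_rV_differentiable x : (forall j, smooth O (fun x => g x 0 j)) ->
  O x -> differentiable g x.
Proof.
by move=> sg Ox; apply: differentiable_rV => j; exact: smooth_differentiable (sg j) Ox.
Qed.

Lemma smooth_comp f : (forall j, smooth O (fun x => g x 0 j)) -> smooth W f ->
  smooth O (f \o g).
Proof.
move=> sg; apply: smooth_comp_generated => [x Ox|v j].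
  exact: smooth_rV_differentiable.
apply: (@generated_eq _ _ _ _ ('D_v (fun x => g x 0 j))).
  by move=> x Ox; rewrite derive_rV //; exact: smooth_rV_differentiable.
by apply: generated_base; left; apply: smooth_derive.
Qed.

End Composition.

Lemma smooth_mulmx (R : realType) m p q (O : set 'rV[R]_m)
    (n : nat) (A : 'rV[R]_m -> 'M[R]_(p, n)) (B : 'rV[R]_m -> 'M[R]_(n, q)) :
  open O ->
  (forall i j, smooth O (fun x => A x i j)) ->
  (forall i j, smooth O (fun x => B x i j)) ->
  forall i j, smooth O (fun x => (A x *m B x) i j).
Proof.
move=> Oo sA sB i j; apply: (@smooth_eq _ _ _
  (fun x => \sum_(k < n) A x i k * B x k j)) => //.
  by move=> x _; rewrite mxE.
by apply: smooth_sum => // k; exact: smoothM.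
Qed.

(** * The inverse function theorem *)

Section MeanValue.
Variables (R : realType) (V : normedModType R).

Lemma is_derive_line (f : V -> R) x v (t : R) : derivable f (t *: v + x) v ->
  is_derive t 1 (fun s : R => f (s *: v + x)) ('D_v f (t *: v + x)).
Proof.
have E : (fun h : R => h^-1 *: (((fun s : R => f (s *: v + x)) \o shift t) (h *: (1 : R))
      - f (t *: v + x))) =
    (fun h : R => h^-1 *: ((f \o shift (t *: v + x)) (h *: v) - f (t *: v + x))).
  by apply/funext => h /=; rewrite [h *: (1 : R)]mulr1 scalerDl addrA.
by move=> df; split; rewrite /derivable /derive E.
Qed.

Lemma mean_value (f : V -> R) x v c :
  (forall t, 0 <= t <= 1 -> derivable f (t *: v + x) v) ->
  (forall t, 0 <= t <= 1 -> `|'D_v f (t *: v + x)| <= c) ->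
  `|f (v + x) - f x| <= c.
Proof.
move=> df fc.
have [|t|t /[!in_itv]/= t01 E] :=
  @MVT_segment R (fun s => f (s *: v + x)) (fun s => 'D_v f (s *: v + x)) 0 1 ler01.
- move=> t; rewrite in_itv /= => /andP[t0 t1].
  by apply: is_derive_line; apply: df; rewrite !ltW.
- apply: derivable_within_continuous => s; rewrite in_itv /= => s01.
  exact: (@ex_derive _ _ _ _ _ _ _ (is_derive_line (df _ s01))).
- move: E; rewrite scale1r scale0r add0r subr0 mulr1 => ->; exact: fc.
Qed.
End MeanValue.

Section InverseFunction.
Variables (R : realType) (n : nat).
Local Notation V := 'rV[R]_n.

(** The mean value inequality holds for scalar functions, so it is applied to each coordinate of
    [f - id] along a segment of the convex ball; the sup norm makes this lossless. *)
Lemma lipschitz_near_id (f : V -> V) (a : V) d :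
  (forall x, `|x - a| <= d -> differentiable f x) ->
  (forall x v, `|x - a| <= d -> `|'D_v f x - v| <= `|v| / 2) ->
  forall x y, `|x - a| <= d -> `|y - a| <= d ->
    `|f x - f y - (x - y)| <= `|x - y| / 2.
Proof.
move=> df Df x y xd yd.
have segd (t : R) : 0 <= t <= 1 -> `|t *: (x - y) + y - a| <= d.
  move=> /andP[t0 t1].
  have -> : t *: (x - y) + y - a = t *: (x - a) + (1 - t) *: (y - a).
    by apply/rowP => i; rewrite !mxE; ring.
  rewrite (le_trans (ler_normD _ _)) // !normrZ (ger0_norm t0).
  rewrite (ger0_norm (_ : 0 <= 1 - t)) ?subr_ge0 //.
  have -> : d = t * d + (1 - t) * d by ring.
  by apply: lerD; apply: ler_wpM2l => //; rewrite subr_ge0.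
apply: norm_le_coord => [|i j]; first by rewrite divr_ge0.
rewrite ord1 !mxE.
have dfj (t : R) : 0 <= t <= 1 ->
    differentiable (fun z : V => f z 0 j) (t *: (x - y) + y).
  by move=> /segd td; apply: differentiable_rV_coord; exact: df.
have dj z : differentiable (fun w : V => w 0 j) z by exact: differentiable_coord.
have := @mean_value R _ (fun z : V => f z 0 j - z 0 j) y (x - y) (`|x - y| / 2).
rewrite subrK => mv.
have -> : f x 0 j - f y 0 j - (x 0 j - y 0 j) =
  f x 0 j - x 0 j - (f y 0 j - y 0 j) by ring.
apply: mv => [t t01|t t01].
  by apply: derivableB; apply: diff_derivable; [exact: dfj|exact: dj].
rewrite deriveB; [|exact/diff_derivable/dfj|exact/diff_derivable/dj].
rewrite -(derive_rV _ _ (df _ (segd _ t01))).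
have -> : 'D_(x - y) (fun z : V => z 0 j) (t *: (x - y) + y) = (x - y) 0 j.
  by rewrite -(@derive_rV R _ _ id) ?derive_id.
have := Df _ (x - y) (segd _ t01).
apply: le_trans; rewrite (le_trans _ (le_coord_norm _ 0 j)) // !mxE.
exact: lexx.
Qed.

Lemma jacobian_coord (f : V -> V) x i j : differentiable f x ->
  ('J f x) i j = 'D_(delta_mx 0 i) (fun y => f y 0 j) x.
Proof.
by move=> df; rewrite -derive_rV // deriveEjacobian // -rowE [RHS]mxE.
Qed.

Lemma smooth_jacobian (O : set V) (f : V -> V) i j : open O ->
  (forall j, smooth O (fun x => f x 0 j)) -> smooth O (fun x => ('J f x) i j).
Proof.
move=> Oo sf; apply: (smooth_eq Oo _ (smooth_derive (delta_mx 0 i) (sf j))) => x Ox.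
by rewrite jacobian_coord //; exact: smooth_rV_differentiable Ox.
Qed.

(** With identity Jacobian at [a], solving [f x = y] amounts to finding a fixed point of
    [x |-> y - (f x - x)], a contraction of ratio 1/2 near [a]. *)
Lemma inverse_function_id (O : set V) (f : V -> V) (a : V) :
  open O -> O a -> (forall j, smooth O (fun x => f x 0 j)) -> 'J f a = 1%:M ->
  exists (W W' : set V) (g : V -> V),
    [/\ [/\ open W, open W', W a & W `<=` O],
       forall x, W x -> W' (f x) /\ g (f x) = x,
       forall y, W' y -> W (g y) /\ f (g y) = y &
       forall j, smooth W' (fun y => g y 0 j)].
Proof.
move=> Oo Oa sf Ja.
have df x : O x -> differentiable f x by move=> Ox; exact: smooth_rV_differentiable Ox.
have sJ i j : smooth O (fun x => ('J f x) i j) by exact: smooth_jacobian.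
have cJ (h : V -> R) : smooth O h -> {for a, continuous h}.
  by move=> sh; apply: differentiable_continuous; exact: smooth_differentiable Oa.
(* If the entries of ['J f x - 1] are at most [c], this matrix stretches the sup norm by at most
   [n * c <= 1/2]; [n.+1] keeps [c] positive when [n = 0]. *)
pose c : R := (2 * n.+1%:R)^-1.
have c0 : 0 < c by rewrite invr_gt0 mulr_gt0.
have near_J : \forall x \near a, forall ij : 'I_n * 'I_n,
    `|('J f x) ij.1 ij.2 - ('J f a) ij.1 ij.2| <= c.
  apply/(@filter_forall _ _ (fun (ij : 'I_n * 'I_n) x => is_true
    (`|('J f x) ij.1 ij.2 - ('J f a) ij.1 ij.2| <= c)) (nbhs a) _) => -[i j] /=.
  have /cvgrPdist_le /(_ _ c0) cv := cJ _ (sJ i j).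
  by near=> x; rewrite distrC; near: x; exact: cv.
have : \forall x \near a, [/\ O x,
    forall i j, `|('J f x - 1%:M) i j| <= c & \det ('J f x) != 0].
  near=> x; split.
  - near: x; exact: open_nbhs_nbhs.
  - near: x; apply: filterS near_J => x xc i j.
    by rewrite -Ja mxE [X in _ + X]mxE; exact: (xc (i, j)).
  - near: x; apply: (cvgr_neq0 (\det ('J f a))).
    + exact: (cJ _ (smooth_det Oo sJ)).
    + by rewrite Ja det1 oner_neq0.
move=> /nbhs_ballP[e /= e0 good].
pose d := e / 2; have d0 : 0 < d by rewrite divr_gt0.
have {}good x : `|x - a| <= d -> [/\ O x,
    forall i j, `|('J f x - 1%:M) i j| <= c & \det ('J f x) != 0].
  move=> xd; apply: good; rewrite -ball_normE /= distrC (le_lt_trans xd) //.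
  by rewrite /d ltr_pdivrMr // ltr_pMr // ltr1n.
have dfd x : `|x - a| <= d -> differentiable f x by move=> /good[/df].
have lip : forall x y, `|x - a| <= d -> `|y - a| <= d ->
    `|f x - f y - (x - y)| <= `|x - y| / 2.
  apply: lipschitz_near_id => // x v xd; have [_ Jc _] := good x xd.
  rewrite deriveEjacobian; last exact: dfd.
  rewrite -[X in _ - X]mulmx1 -mulmxBr.
  rewrite (le_trans (norm_mulmx_le v (ltW c0) Jc)) // mulrC ler_wpM2l //.
  rewrite /c invfM mulrCA ler_piMr ?invr_ge0 //.
  by rewrite ler_pdivrMr ?ltr0n // mul1r ler_nat.
(* As [f - id] is Lipschitz with constant 1/2, [f] cannot shrink distances by more than a factor 2:
   solutions are unique and the inverse is Lipschitz. *)
have expand x y : `|x - a| <= d -> `|y - a| <= d -> `|x - y| <= 2 * `|f x - f y|.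
  move=> xd yd; have := lip x y xd yd.
  have : `|x - y| <= `|f x - f y| + `|f x - f y - (x - y)|.
    move: (x - y) (f x - f y) => u v.
    have {1}-> : u = v - (v - u) by rewrite opprB addrC subrK.
    exact: ler_normB.
  by move: (`|x - y|) => u; lra.
(* The radius [d / 2]: in [phi x - a] below, [y - f a] contributes less than [d / 2] and [f - id] at
   most [d / 2], so the ball of radius [d] is mapped into itself. *)
pose W' : set V := ball (f a) (d / 2).
pose W : set V := ball a d `&` f @^-1` W'.
have Wd x : W x -> `|x - a| <= d.
  by move=> [+ _]; rewrite -ball_normE /= distrC => /ltW.
have W'o : open W' by exact: ball_open.
have Wo : open W.
  rewrite openE => x Wx; apply: filterI.
    by apply: open_nbhs_nbhs; split; [exact: ball_open|exact: Wx.1].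
  apply: (differentiable_continuous (dfd _ (Wd _ Wx))).
  by apply: open_nbhs_nbhs; split => //; exact: Wx.2.
(* Placing [W' y] under the quantifier lets [choice] return a total function; off [W'] the value [a]
   is arbitrary. *)
have solve y : exists x, W' y -> `|x - a| < d /\ f x = y.
  have [W'y|nW'y] := pselect (W' y); last by exists a.
  pose C : set V := [set x | `|x - a| <= d].
  pose phi x := y - (f x - x).
  have phid x : C x -> `|phi x - a| < d.
    move=> Cx; have -> : phi x - a = (y - f a) - (f x - f a - (x - a)).
      by apply/rowP => i; rewrite !mxE; ring.
    rewrite (le_lt_trans (ler_normB _ _)) //.
    have := lip x a Cx; rewrite subrr normr0 => /(_ (ltW d0)).
    move: W'y; rewrite /W' -ball_normE /= distrC; move: Cx; rewrite /C /=.
    by move: (`|x - a|) => u; lra.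
  have phiC : {homo phi : x / C x >-> C x} by move=> x Cx; exact/ltW/phid.
  pose cV : completeNormedModType R := HB.pack V (Complete.on V) (NormedModule.on V).
  have [|||x Cx xE] := @banach_fixed_point R cV C (mkfun_fun phiC).
  - exists (2^-1)%:nng; split => /=.
      by rewrite invf_lt1 // ltr1n.
    move=> [u v] [/= Cu Cv].
    rewrite /mkfun /phi; have -> : y - (f u - u) - (y - (f v - v)) =
      - (f u - f v - (u - v)) by apply/rowP => i; rewrite !mxE; ring.
    by rewrite normrN mulrC; exact: lip.
  - rewrite /C.
    have -> : [set x : V | `|x - a| <= d] = closed_ball a d.
      rewrite closed_ballE //; apply/seteqP; split => x; rewrite /closed_ball_ /= distrC //.
    exact: closed_ball_closed.
  - by exists a; rewrite /C /= subrr normr0 ltW.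
  exists x => _; split; first by rewrite xE; exact: phid.
  have {}xE : x = y - (f x - x) by exact: xE.
  by apply/rowP => i; move: xE => /rowP/(_ i); rewrite !mxE; lra.
have [g gP] := choice solve.
have gd y : W' y -> `|g y - a| <= d by move=> /gP[/ltW].
have fgK y : W' y -> f (g y) = y by move=> /gP[].
have gW y : W' y -> W (g y).
  move=> W'y; split; last by rewrite /preimage /= fgK.
  by rewrite -ball_normE /= distrC; have [] := gP y W'y.
pose J x := 'J f x.
have uJ x : W x -> J x \in unitmx.
  by move=> /Wd /good[_ _]; rewrite unitmxE unitfE.
have diffg y : W' y -> differentiable g y /\
    'd g y = mulmxr (invmx (J (g y))) :> (V -> V).
  move=> W'y; apply: differentiable_epsP; first exact: mulmx_continuous.
  set x0 := g y; set M := invmx _ => e1 e10.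
  (* The error [rho] is at most [e1 / k] times [2 |h|], and multiplying it by [M] costs [n |M|]; the
     summand 1 makes [k] positive. *)
  pose k := n%:R * `|M| * 2 + 1.
  have k0 : 0 < k by rewrite ltr_wpDl // !mulr_ge0.
  have := differentiable_eps (dfd _ (gd _ W'y)) (divr_gt0 e10 k0).
  move=> /nbhs_norm0P[r /= r0 Hr].
  have near_hr : \forall h \near (0 : V), `|h| < r / 2.
    by apply/nbhs_norm0P; exists (r / 2) => //=; rewrite divr_gt0.
  near=> h.
  have W'hy : W' (h + y).
    by near: h; apply: (@near_translate _ _ W' y); exact: open_nbhs_nbhs.
  set x := g (h + y).
  have xx0 : `|x - x0| <= 2 * `|h|.
    have := expand _ _ (gd _ W'hy) (gd _ W'y).
    by rewrite !fgK // addrK.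
  have hr : `|h| < r / 2 by near: h; exact: near_hr.
  have xr : `|x - x0| < r by apply: le_lt_trans xx0 _; rewrite mulrC -ltr_pdivlMr.
  have := Hr _ xr; rewrite subrK /x !fgK // addrK -/x -/x0.
  rewrite -(deriveE _ (dfd _ (gd _ W'y))) deriveEjacobian; last exact/dfd/gd.
  rewrite -/(J _) -/x0; set rho := h - _ => rhole.
  have -> : x - x0 - h *m M = - (rho *m M).
    by rewrite mulmxBl -mulmxA mulmxV ?mulmx1 ?opprB //; exact/uJ/gW.
  rewrite normrN.
  have := @norm_mulmx_le R n n rho M `|M| (normr_ge0 _) (le_coord_norm M).
  move=> /le_trans; apply.
  have rho2 : `|rho| <= (e1 / k) * (2 * `|h|).
    by apply: le_trans rhole _; rewrite ler_wpM2l // divr_ge0 ?ltW.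
  apply: le_trans (ler_wpM2l _ rho2) _; first by rewrite mulr_ge0.
  have -> : n%:R * `|M| * (e1 / k * (2 * `|h|)) =
    (e1 * `|h|) * ((n%:R * `|M| * 2) / k) by ring.
  rewrite ler_piMr //; first by rewrite mulr_ge0 // ltW.
  by rewrite ler_pdivrMr // mul1r /k lerDl.
exists W, W', g; split => //.
- split => //; last by move=> x /Wd /good[].
  split; first exact: ballxx.
  by rewrite /W' /preimage /=; apply: ballxx; rewrite divr_gt0.
- move=> x Wx; split; first exact: Wx.2.
  have W'fx : W' (f x) by exact: Wx.2.
  have := expand _ _ (gd _ W'fx) (Wd _ Wx).
  by rewrite fgK // subrr normr0 mulr0 normr_le0 subr_eq0 => /eqP.
- by move=> y W'y; split; [exact: gW|exact: fgK].
(* The derivative of [g] is the inverse Jacobian evaluated at [g], again a smooth function composed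
   with [g]: differentiability alone thus bootstraps to smoothness. *)
- move=> j; apply: (@smooth_comp_generated _ _ _ W' W g W'o gW _ _ (fun x => x 0 j)).
  + by move=> y /diffg[].
  + move=> v i; apply: (@generated_eq _ _ _ _ (fun y => \sum_(l < n)
      cst (v 0 l) y * (((fun x => invmx (J x) l i) \o g) y))).
      move=> y W'y; have [dgy dgE] := diffg y W'y.
      by rewrite deriveE // dgE /= mxE.
    apply: generated_sum => l; apply: generatedM; first exact: generated_cst.
    apply: generated_base; right; exists (fun x => invmx (J x) l i) => //.
    apply: smooth_invmx => // p q.
    by apply: sub_smooth (sJ p q) => x /Wd /good[].
  + exact: smooth_coord.
Unshelve. all: by end_near. Qed.

Theorem inverse_function (O : set V) (f : V -> V) (a : V) :
  open O -> O a -> (forall j, smooth O (fun x => f x 0 j)) -> 'J f a \in unitmx ->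
  exists (W W' : set V) (g : V -> V),
    [/\ [/\ open W, open W', W a & W `<=` O],
       forall x, W x -> W' (f x) /\ g (f x) = x,
       forall y, W' y -> W (g y) /\ f (g y) = y &
       forall j, smooth W' (fun y => g y 0 j)].
Proof.
move=> Oo Oa sf uJ; pose M := invmx ('J f a).
have dfa : differentiable f a by exact: smooth_rV_differentiable Oa.
have sM (P Q : set V) (h : V -> V) (N : 'M[R]_n) : open P ->
    (forall j, smooth P (fun x => h x 0 j)) ->
    forall j, smooth P (fun x => (h x *m N) 0 j).
  move=> Po sh j; apply: smooth_mulmx => // [i k|i k].
    by rewrite ord1.
  exact: smooth_cst.
have JM : 'J (fun x => f x *m M) a = 1%:M.
  apply/row_matrixP => i; rewrite !rowE.
  rewrite -deriveEjacobian; last first.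
    by apply: smooth_rV_differentiable Oa; exact: sM.
  rewrite deriveE; last by apply: smooth_rV_differentiable Oa; exact: sM.
  have -> : (fun x => f x *m M) = mulmxr M \o f by [].
  rewrite diff_comp //; last exact/linear_differentiable/mulmx_continuous.
  rewrite [X in X \o _]diff_lin; last exact: mulmx_continuous.
  by rewrite /= -deriveE // deriveEjacobian // -mulmxA mulmxV // mulmx1.
have [W [W' [g [[Wo W'o Wa WO] gf fg sg]]]] :=
  inverse_function_id Oo Oa (sM _ O _ M Oo sf) JM.
have MK : M *m 'J f a = 1%:M by rewrite mulVmx.
have JK : 'J f a *m M = 1%:M by rewrite mulmxV.
pose W1 := mulmxr M @^-1` W'.
have W1o : open W1.
  by apply: open_comp W'o => x _; exact: mulmx_continuous.
exists W, W1, (fun y => g (y *m M)); split => //.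
- move=> y W1y; have [Wy E] := fg _ W1y; split => //.
  by rewrite -[LHS]mulmx1 -MK mulmxA E -mulmxA MK mulmx1.
- move=> j; apply: (@smooth_comp _ _ _ W1 W' (mulmxr M) W1o _ (fun y => g y 0 j)) => //.
  by apply: (@sM W1 W1 id M W1o) => k; exact: smooth_coord.
Qed.

End InverseFunction.

(** * Exponentials of matrices *)

Lemma cvg_sum (R : realType) (T I : Type) (F : set_system T) {FF : Filter F}
    (r : seq I) (f : I -> T -> R) (a : I -> R) :
  (forall i, f i t @[t --> F] --> a i) ->
  \sum_(i <- r) f i t @[t --> F] --> \sum_(i <- r) a i.
Proof.
move=> fa; elim: r => [|i r IH].
  under eq_fun do rewrite big_nil.
  by rewrite big_nil; exact: cvg_cst.
under eq_fun do rewrite big_cons.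
by rewrite big_cons; exact: cvgD.
Qed.

Section MatrixDerivative.
Variable R : realType.

Definition is_derive_mx m n (F : R -> 'M[R]_(m, n)) (t : R) (F' : 'M[R]_(m, n)) :=
  forall i j, is_derive t (1 : R) (fun s => F s i j) (F' i j).

Lemma is_derive_mx_cst m n (M : 'M[R]_(m, n)) t : is_derive_mx (cst M) t 0.
Proof. by move=> i j; rewrite mxE; exact: is_derive_cst. Qed.

Lemma is_derive_mxM m n p (F : R -> 'M[R]_(m, n)) (G : R -> 'M[R]_(n, p)) t F' G' :
  is_derive_mx F t F' -> is_derive_mx G t G' ->
  is_derive_mx (fun s => F s *m G s) t (F' *m G t + F t *m G').
Proof.
move=> dF dG i j; rewrite (_ : (fun s => _) =
    \sum_(k < n) ((fun s => F s i k) * (fun s => G s k j))); last first.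
  by apply/funext => s; rewrite mxE fct_sumE.
have dFG k : is_derive t (1 : R) ((fun s => F s i k) * (fun s => G s k j))
    (F t i k *: G' k j + G t k j *: F' i k).
  by apply: is_deriveM.
apply: is_derive_eq (is_derive_sum dFG) _.
rewrite !mxE -big_split /=; apply: eq_bigr => k _.
by rewrite addrC /GRing.scale /= [_ * F' i k]mulrC.
Qed.

Lemma is_derive_mx0_cst m n (F : R -> 'M[R]_(m, n)) t :
  (forall s, is_derive_mx F s 0) -> F t = F 0.
Proof.
move=> dF; apply/matrixP => i j; apply: (@is_derive_0_is_cst _ (fun s => F s i j)).
by move=> s; have := dF s i j; rewrite mxE.
Qed.

End MatrixDerivative.

Section Exponential.
Variables (R : realType) (n : nat) (X : 'M[R]_n).

Let pow k := iter k (mulmx X) 1%:M.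

Let powSr k : pow k.+1 = pow k *m X.
Proof.
by elim: k => [|k IH]; rewrite /pow /= ?mulmx1 ?mul1mx // -mulmxA -[in RHS]IH.
Qed.

Let B := n%:R * `|X|.

Let B_ge0 : 0 <= B. Proof. by rewrite mulr_ge0. Qed.

Let pow_le k i j : `|pow k i j| <= B ^+ k.
Proof.
elim: k i j => [|k IH] i j.
  rewrite expr0 mxE; case: eqP => _; rewrite ?normr1 ?normr0 ?ler01 //.
rewrite [pow _]/(X *m pow k) mxE (le_trans (ler_norm_sum _ _ _)) //.
have -> : B ^+ k.+1 = \sum_(l < n) `|X| * B ^+ k.
  by rewrite sumr_const card_ord exprS /B -mulrA mulr_natl.
apply: ler_sum => l _; rewrite normrM ler_pM //; exact: le_coord_norm.
Qed.

(** Comparison with the series of [exp (B |t|)]; [K] absorbs the powers of [B] that appear when the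
    coefficients are differentiated. *)
Let cvg_pseries (a : R^nat) K t : (forall k, `|a k| <= K * (B ^+ k / k`!%:R)) ->
  cvgn (pseries a t).
Proof.
move=> aK; apply: normed_cvg; apply: series_le_cvg (_ : cvgn (series
  (K *: exp_coeff (B * `|t|)))); last exact/is_cvg_seriesZ/is_cvg_series_exp_coeff.
- by move=> k; exact: normr_ge0.
- move=> k; rewrite -[(_ *: _) k]/(K * _).
  have K0 : 0 <= K.
    have := aK 0%N; rewrite expr0 fact0 divr1 mulr1; exact: le_trans.
  by rewrite mulr_ge0 // exp_coeff_ge0 // mulr_ge0.
- move=> k; rewrite -[(_ *: _) k]/(K * (_ ^+ _ / _)) /=.
  rewrite normrM normrX exprMn [_ * _ / _]mulrAC mulrA ler_wpM2r ?exprn_ge0 //.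
Qed.

Let c i j k := pow k i j / k`!%:R.

Let c_le i j k : `|c i j k| <= 1 * (B ^+ k / k`!%:R).
Proof. by rewrite mul1r /c normrM normfV normr_nat ler_wpM2r. Qed.

Let diffs_c i j k : pseries_diffs (c i j) k = pow k.+1 i j / k`!%:R.
Proof.
rewrite /pseries_diffs /c factS natrM invfM mulrCA.
by rewrite mulVKf // pnatr_eq0.
Qed.

Let cvg_c i j t : cvgn (pseries (c i j) t).
Proof. exact: cvg_pseries (c_le i j). Qed.

Let cvg_diffs_c i j t : cvgn (pseries (pseries_diffs (c i j)) t).
Proof.
apply: (@cvg_pseries _ B) => k; rewrite diffs_c normrM normfV normr_nat.
by rewrite mulrA ler_wpM2r // -exprS.
Qed.

Let cvg_diffs2_c i j t : cvgn (pseries (pseries_diffs (pseries_diffs (c i j))) t).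
Proof.
apply: (@cvg_pseries _ (B ^+ 2)) => k.
rewrite {1}/pseries_diffs diffs_c factS natrM invfM.
rewrite [X in `|X|](_ : _ = pow k.+2 i j / k`!%:R); last first.
  by rewrite mulrCA mulVKf // pnatr_eq0.
by rewrite normrM normfV normr_nat mulrA ler_wpM2r // -exprD.
Qed.

Let E t : 'M[R]_n := \matrix_(i, j) limn (pseries (c i j) t).

Let lim_diffs_l i j t : limn (pseries (pseries_diffs (c i j)) t) = (X *m E t) i j.
Proof.
apply/cvg_lim => //; rewrite mxE.
rewrite (_ : pseries _ t = \sum_(l < n) (fun N => X i l * pseries (c l j) t N)).
  rewrite fct_sumE; apply: cvg_sum => l; rewrite [E t l j]mxE.
  by apply: cvgMl_tmp; exact: cvg_c.
apply/funext => N; rewrite fct_sumE /pseries /series /=.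
under [RHS]eq_bigr do rewrite mulr_sumr.
rewrite exchange_big /=; apply: eq_bigr => k _.
rewrite diffs_c [pow _]/(X *m pow k) mxE !mulr_suml; apply: eq_bigr => l _.
by rewrite /c !mulrA.
Qed.

Let commute t : X *m E t = E t *m X.
Proof.
apply/matrixP => i j; rewrite -lim_diffs_l.
apply/cvg_lim => //; rewrite mxE.
rewrite (_ : pseries _ t = \sum_(l < n) (fun N => pseries (c i l) t N * X l j)).
  rewrite fct_sumE; apply: cvg_sum => l; rewrite [E t i l]mxE.
  by apply: cvgMr_tmp; exact: cvg_c.
apply/funext => N; rewrite fct_sumE /pseries /series /=.
under [RHS]eq_bigr do rewrite mulr_suml.
rewrite exchange_big /=; apply: eq_bigr => k _.
rewrite diffs_c powSr mxE !mulr_suml; apply: eq_bigr => l _.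
by rewrite /c; ring.
Qed.

(** Termwise differentiation turns the coefficients [X^k / k!] into [X^(k+1) / k!], which sum to
    [X *m E t]; and [X] commutes with its powers. *)
Lemma exists_exponential : exists E : R -> 'M[R]_n,
  [/\ E 0 = 1%:M, forall t, is_derive_mx E t (X *m E t) &
      forall t, X *m E t = E t *m X].
Proof.
exists E; split; [|move=> t i j|exact: commute].
- apply/matrixP => i j; rewrite mxE; apply/cvg_lim => //.
  apply: cvg_near_cst; near=> N.
  rewrite /pseries /series /=; have [N' ->] : exists N', N = N'.+1.
    by exists N.-1; rewrite prednK //; near: N; exact: nbhs_infty_gt.
  rewrite big_nat_recl // expr0 mulr1 big1 ?addr0 => [|k _].
    by rewrite /c fact0 divr1.
  by rewrite expr0n mulr0.
- rewrite -lim_diffs_l (_ : (fun s => _) = (fun s => limn (pseries (c i j) s))).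
    (* Termwise differentiation at [t] asks for convergence at a point of strictly larger
       modulus. *)
    apply: (@pseries_snd_diffs _ _ (`|t| + 1)) => //.
    by rewrite [ltRHS]ger0_norm ?ltrDl // addr_ge0.
  by apply/funext => s; rewrite mxE.
Unshelve. all: by end_near. Qed.

End Exponential.

(** * Automorphisms and derivations of a bilinear product *)

Section UltraLimits.
Variables (R : realType) (T : Type) (F : set_system T).

Lemma ultra_fmap (U : Type) (f : T -> U) : UltraFilter F -> UltraFilter (f @ F).
Proof.
move=> FU; split; first exact: fmap_proper_filter.
move=> G GF FG; apply/seteqP; split => A; last exact: FG.
move=> GA; have [//|FnA] := in_ultra_setVsetC (f @^-1` A) FU.
have /filter_ex[? []//] : G (A `&` ~` A) by apply: filterI => //; exact: FG.
Qed.

Lemma ultra_bounded_cvg (u : T -> R) B : UltraFilter F ->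
  (forall t, `|u t| <= B) -> exists l : R, u @ F --> l.
Proof.
move=> FU uB; have := @segment_compact R (- B) B.
rewrite compact_ultra => /(_ (u @ F) (ultra_fmap u FU)) [].
  suff : F (u @^-1` [set` `[- B, B]]) by [].
  by apply: filterE => t; have := uB t; rewrite ler_norml /preimage /= in_itv.
by move=> l [_ ul]; exists l.
Qed.

Definition mx_cvg m n (u : T -> 'M[R]_(m, n)) (L : 'M[R]_(m, n)) :=
  forall i j, u t i j @[t --> F] --> L i j.

(** Along an ultrafilter all entries converge at once, by compactness of segments: no successive
    extraction of subsequences. *)
Lemma ultra_bounded_mx_cvg m n (u : T -> 'M[R]_(m, n)) B : UltraFilter F ->
  (forall t i j, `|u t i j| <= B) -> exists L, mx_cvg u L.
Proof.
move=> FU uB.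
have lim ij : exists l : R, u t ij.1 ij.2 @[t --> F] --> l.
  by apply: (@ultra_bounded_cvg _ B).
have [l lP] := choice lim.
by exists (\matrix_(i, j) l (i, j)) => i j; rewrite mxE; exact: (lP (i, j)).
Qed.

Context {FF : ProperFilter F}.

Lemma cvg_cst_eq (u : T -> R) c l :
  (forall t, u t = c) -> u t @[t --> F] --> l -> l = c.
Proof.
move=> uc ul; apply: (norm_cvg_unique ul).
by rewrite (_ : u = cst c); [exact: cvg_cst|exact/funext].
Qed.

Lemma mx_cvg_cst m n (L : 'M[R]_(m, n)) : mx_cvg (fun=> L) L.
Proof. by move=> i j; exact: cvg_cst. Qed.

Lemma mx_cvgD m n (u v : T -> 'M[R]_(m, n)) L M :
  mx_cvg u L -> mx_cvg v M -> mx_cvg (fun t => u t + v t) (L + M).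
Proof.
by move=> uL vM i j; under eq_fun do rewrite mxE; rewrite mxE; exact: cvgD.
Qed.

Lemma mx_cvgB m n (u v : T -> 'M[R]_(m, n)) L M :
  mx_cvg u L -> mx_cvg v M -> mx_cvg (fun t => u t - v t) (L - M).
Proof.
by move=> uL vM i j; under eq_fun do rewrite !mxE; rewrite !mxE; exact: cvgB.
Qed.

Lemma mx_cvgM m n p (u : T -> 'M[R]_(m, n)) (v : T -> 'M[R]_(n, p)) L M :
  mx_cvg u L -> mx_cvg v M -> mx_cvg (fun t => u t *m v t) (L *m M).
Proof.
move=> uL vM i j; under eq_fun do rewrite mxE; rewrite mxE.
by apply: cvg_sum => k; exact: cvgM.
Qed.

Lemma mx_cvg_unique m n (u : T -> 'M[R]_(m, n)) L M :
  mx_cvg u L -> mx_cvg u M -> L = M.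
Proof.
move=> uL uM; apply/matrixP => i j.
exact: (@cvg_unique _ _ _ _ _ _ (uL i j) (uM i j)).
Qed.

(** The squared Euclidean norm: a polynomial in the entries, unlike the sup norm, so that it can be
    differentiated at a minimum. *)
Definition sqnorm m n (M : 'M[R]_(m, n)) := \sum_i \sum_j M i j ^+ 2.

Lemma cvg_sqnorm m n (u : T -> 'M[R]_(m, n)) L :
  mx_cvg u L -> sqnorm (u t) @[t --> F] --> sqnorm L.
Proof.
by move=> uL; apply: cvg_sum => i; apply: cvg_sum => j; exact: cvgM.
Qed.

End UltraLimits.
Arguments mx_cvg_cst {R T} F {FF m n} L.

Lemma sqnorm_ge0 (R : realType) m n (M : 'M[R]_(m, n)) : 0 <= sqnorm M.
Proof. by apply: sumr_ge0 => i _; apply: sumr_ge0 => j _; exact: sqr_ge0. Qed.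

Lemma sqr_coord_le_sqnorm (R : realType) m n (M : 'M[R]_(m, n)) i j :
  M i j ^+ 2 <= sqnorm M.
Proof.
rewrite /sqnorm (bigD1 i) //= (bigD1 j) //= -addrA lerDl addr_ge0 //.
  by apply: sumr_ge0 => k _; exact: sqr_ge0.
by apply: sumr_ge0 => k _; apply: sumr_ge0 => l _; exact: sqr_ge0.
Qed.

Lemma sqnorm_le0 (R : realType) m n (M : 'M[R]_(m, n)) : sqnorm M <= 0 -> M = 0.
Proof.
move=> M0; apply/matrixP => i j; rewrite mxE; apply/eqP.
by rewrite -sqrf_eq0 eq_le sqr_ge0 (le_trans (sqr_coord_le_sqnorm M i j)).
Qed.

Lemma sqnormZ (R : realType) m n (M : 'M[R]_(m, n)) c :
  sqnorm (c *: M) = c ^+ 2 * sqnorm M.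
Proof.
rewrite /sqnorm mulr_sumr; apply: eq_bigr => i _; rewrite mulr_sumr.
by apply: eq_bigr => j _; rewrite mxE exprMn.
Qed.

(** * Bilinear products given by structure constants *)

Section Product.
Variables (R : realType) (n : nat) (C : 'I_n -> 'M[R]_n).
Implicit Types (x y : 'rV[R]_n) (D g : 'M[R]_n).

(* [C p] has the products of the p-th basis vector with the basis as rows. *)
Definition rmul_mx y : 'M[R]_n := \matrix_p (y *m C p).
Definition product x y := x *m rmul_mx y.

Lemma rmul_mxE y p j : rmul_mx y p j = (y *m C p) 0 j.
Proof. by rewrite mxE. Qed.

Lemma rmul_mxD y z : rmul_mx (y + z) = rmul_mx y + rmul_mx z.
Proof. by apply/matrixP => p j; rewrite [RHS]mxE !rmul_mxE mulmxDl mxE. Qed.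

Lemma rmul_mxZ c y : rmul_mx (c *: y) = c *: rmul_mx y.
Proof. by apply/matrixP => p j; rewrite [RHS]mxE !rmul_mxE -scalemxAl mxE. Qed.

Lemma productDl x y z : product (x + y) z = product x z + product y z.
Proof. exact: mulmxDl. Qed.
Lemma productDr x y z : product x (y + z) = product x y + product x z.
Proof. by rewrite /product rmul_mxD mulmxDr. Qed.
Lemma productZl c x y : product (c *: x) y = c *: product x y.
Proof. by rewrite /product -scalemxAl. Qed.
Lemma productZr c x y : product x (c *: y) = c *: product x y.
Proof. by rewrite /product rmul_mxZ scalemxAr. Qed.
Lemma product0l y : product 0 y = 0.
Proof. exact: mul0mx. Qed.

Lemma product0r x : product x 0 = 0.
Proof. by rewrite -(scale0r (0 : 'rV[R]_n)) productZr !scale0r. Qed.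

Lemma mx_cvg_product (T : Type) (F : set_system T) {FF : ProperFilter F}
    (u v : T -> 'rV[R]_n) L M :
  mx_cvg F u L -> mx_cvg F v M -> mx_cvg F (fun t => product (u t) (v t)) (product L M).
Proof.
move=> uL vM; apply: mx_cvgM => // p j; under eq_fun do rewrite mxE.
by rewrite mxE; apply: mx_cvgM => //; exact: mx_cvg_cst.
Qed.

Lemma is_derive_mx_product (u v : R -> 'rV[R]_n) t u' v' :
  is_derive_mx u t u' -> is_derive_mx v t v' ->
  is_derive_mx (fun s => product (u s) (v s)) t (product u' (v t) + product (u t) v').
Proof.
move=> du dv; apply: is_derive_mxM => // p j.
rewrite (_ : (fun s => _) = fun s => (v s *m C p) 0 j); last first.
  by apply/funext => s; rewrite rmul_mxE.
have := is_derive_mxM dv (is_derive_mx_cst (C p) t).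
by rewrite mulmx0 addr0 => /(_ 0 j); rewrite [rmul_mx _ _ _]mxE.
Qed.

Definition derivation D :=
  forall x y, product x y *m D = product (x *m D) y + product x (y *m D).

Lemma derivation0 : derivation 0.
Proof. by move=> x y; rewrite !mulmx0 product0l product0r addr0. Qed.

Lemma derivation_linear c D D' : derivation D -> derivation D' ->
  derivation (c *: D + D').
Proof.
move=> dD dD' x y.
rewrite !mulmxDr -!scalemxAr dD dD' productDl productDr productZl productZr.
by rewrite scalerDr addrACA.
Qed.

Variable one : 'rV[R]_n.

(** Fixing [one] stands in for invertibility: unlike the latter it visibly passes to limits, and
    [automorphism_unit] recovers invertibility from it. *)
Definition automorphism g :=
  one *m g = one /\ forall x y, product x y *m g = product (x *m g) (y *m g).

Lemma automorphismM g h : automorphism g -> automorphism h -> automorphism (g *m h).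
Proof.
move=> [g1 gM] [h1 hM]; split; first by rewrite mulmxA g1.
by move=> x y; rewrite !mulmxA gM hM.
Qed.

Lemma automorphism1 : automorphism 1%:M.
Proof. by split => [|x y]; rewrite !mulmx1. Qed.

Lemma automorphism_mx_cvg (T : Type) (F : set_system T) {FF : ProperFilter F}
    (u : T -> 'M[R]_n) L :
  (forall t, automorphism (u t)) -> mx_cvg F u L -> automorphism L.
Proof.
move=> au uL; have E x : mx_cvg F (fun t => x *m u t) (x *m L).
  by apply: mx_cvgM => //; exact: mx_cvg_cst.
split=> [|x y].
  apply: (mx_cvg_unique (E one)).
  rewrite (_ : (fun t => _) = cst one); first exact: mx_cvg_cst.
  by apply/funext => t; have [] := au t.
apply: (mx_cvg_unique (E (product x y))).
rewrite (_ : (fun t => _) = fun t => product (x *m u t) (y *m u t)).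
  exact: mx_cvg_product.
by apply/funext => t; have [] := au t.
Qed.

Hypotheses (one0 : one != 0) (oneP : forall x, product one x = x /\ product x one = x).
Hypothesis invP : forall x, x != 0 -> exists y, product x y = one.
Hypothesis sqrP : forall x, product x x = 0 -> x = 0.

(** A nonzero [x] killed by [g] has a right inverse [y]; applying [g] to [x y = one] would give
    [0 = one]. *)
Lemma automorphism_unit g : automorphism g -> g \in unitmx.
Proof.
move=> [g1 gM]; rewrite -row_free_unit -kermx_eq0; apply/eqP/row_matrixP => i; rewrite row0.
set x := row i _; have xg : x *m g = 0.
  by rewrite -row_mul mulmx_ker row0.
apply/eqP; apply/negPn/negP => /invP[y xy].
have := gM x y; rewrite xy g1 xg product0l => /eqP.
by rewrite (negPf one0).
Qed.

Lemma automorphismV g : automorphism g -> automorphism (invmx g).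
Proof.
move=> ag; have ug := automorphism_unit ag; case: ag => g1 gM.
have gK : g *m invmx g = 1%:M by rewrite mulmxV.
have Kg : invmx g *m g = 1%:M by rewrite mulVmx.
split; first by rewrite -{1}g1 -mulmxA gK mulmx1.
move=> x y; rewrite -[RHS]mulmx1 -gK mulmxA gM.
by rewrite -[x *m _ *m g]mulmxA -[y *m _ *m g]mulmxA Kg !mulmx1.
Qed.

Lemma derivation_one D : derivation D -> one *m D = 0.
Proof.
move=> dD; have := dD one one.
rewrite (proj1 (oneP one)) (proj2 (oneP (one *m D))).
by move=> /eqP; rewrite (proj1 (oneP _)) -subr_eq subrr eq_sym => /eqP.
Qed.

(** The curve [psi s], the product of [x *m E s] and [y *m E s] followed by [E (t - s)], is
    constant: the Leibniz rule for [D] cancels the derivative of the last factor. Comparing [s = 0]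
    with [s = t] gives multiplicativity without the addition law of the exponential. *)
Lemma automorphism_exponential D (E : R -> 'M[R]_n) : derivation D ->
  E 0 = 1%:M -> (forall t, is_derive_mx E t (D *m E t)) ->
  (forall t, D *m E t = E t *m D) -> forall t, automorphism (E t).
Proof.
move=> dD E0 dE DE t.
have dx (x : 'rV[R]_n) s : is_derive_mx (fun s => x *m E s) s (x *m (D *m E s)).
  have := is_derive_mxM (is_derive_mx_cst x s) (dE s).
  by rewrite mul0mx add0r.
split.
  rewrite (@is_derive_mx0_cst _ _ _ (fun s => one *m E s)) ?E0 ?mulmx1 // => s.
  by have := dx one s; rewrite mulmxA derivation_one // mul0mx.
move=> x y.
have dEt s : is_derive_mx (fun s => E (t - s)) s (- (D *m E (t - s))).
  move=> i j; rewrite mxE.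
  have dts : is_derive s (1 : R) (fun s : R => t - s) (- 1).
    by have := @is_deriveB _ _ _ (cst t) id s (1 : R) _ _
      (is_derive_cst _ _ _) (is_derive_id _ _); rewrite sub0r.
  have := @is_derive1_comp _ (fun u => E u i j) (fun s => t - s) s _ _ (dE (t - s) i j) dts.
  by rewrite mulrN1.
pose psi s := product (x *m E s) (y *m E s) *m E (t - s).
have psi0 : psi t = psi 0.
  apply: is_derive_mx0_cst => s.
  have := is_derive_mxM (is_derive_mx_product (dx x s) (dx y s)) (dEt s).
  rewrite !DE !mulmxA -dD -[_ *m D *m _]mulmxA DE.
  by rewrite mulmxN mulmxA subrr.
by move: psi0; rewrite /psi subrr subr0 E0 !mulmx1.
Qed.

End Product.

(** * Boundedness of the automorphism group and transversality of the orbit *)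

Section Compactness.
Variables (R : realType) (n : nat) (C : 'I_n -> 'M[R]_n) (one : 'rV[R]_n).
Implicit Types (x y a : 'rV[R]_n) (D g : 'M[R]_n).
Local Notation product := (product C).
Local Notation automorphism := (automorphism C one).
Local Notation derivation := (derivation C).

Hypotheses (one0 : one != 0) (oneP : forall x, product one x = x /\ product x one = x).
Hypothesis invP : forall x, x != 0 -> exists y, product x y = one.
Hypothesis sqrP : forall x, product x x = 0 -> x = 0.

(** [c] is the minimum of [|x x|] on the unit sphere, positive because only 0 has square 0; both
    sides are homogeneous of degree 2. *)
Lemma sqr_lower_bound : exists2 c : R, 0 < c & forall x, c * `|x| ^+ 2 <= `|product x x|.
Proof.
pose S := [set x : 'rV[R]_n | `|x| = 1].
have S0 : S !=set0.
  exists (`|one|^-1 *: one); rewrite /S /= normrZ normfV normr_id mulVf //.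
  by rewrite normr_eq0.
have Sc : compact S.
  apply: bounded_closed_compact.
    by exists 1; split => // r r1 x /= ->; exact: ltW.
  apply: (@closed_comp _ _ (fun x : 'rV[R]_n => `|x|) [set 1]).
    by move=> x _; exact: norm_continuous.
  exact: closed_eq.
pose f x := `|product x x|.
have fc : {within S, continuous f}.
  apply: continuous_subspaceT => x.
  apply: (@continuous_comp _ _ _ (fun x => product x x) (fun y : 'rV[R]_n => `|y|));
    last exact: norm_continuous.
  apply: differentiable_continuous; apply: differentiable_rV => j.
  apply: (@smooth_differentiable _ _ setT) => //; apply: smooth_mulmx.
  - exact: openT.
  - by move=> i k; rewrite ord1; apply: smooth_coord; exact: openT.
  move=> i k; apply: (@smooth_eq _ _ _ (fun y => (y *m C i) 0 k)).
  - exact: openT.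
  - by move=> y _; rewrite rmul_mxE.
  apply: smooth_mulmx; first exact: openT.
  - by move=> p q; rewrite ord1; apply: smooth_coord; exact: openT.
  - by move=> p q; apply: smooth_cst; exact: openT.
have [x0 x0S x0min] := EVT_min_rV S0 Sc fc.
exists (f x0).
  rewrite /f normr_gt0; apply/eqP => /sqrP x00; move: x0S; rewrite inE /S /= x00.
  by rewrite normr0 => /esym/eqP; rewrite oner_eq0.
move=> x; have [->|x_neq0] := eqVneq x 0.
  by rewrite normr0 expr0n mulr0.
have nx : 0 < `|x| by rewrite normr_gt0.
have := x0min (`|x|^-1 *: x); rewrite inE /S /= normrZ normfV normr_id.
rewrite mulVf ?gt_eqF // => /(_ erefl).
rewrite {2}/f productZl productZr scalerA normrZ normrM normfV normr_id.
by rewrite -invfM -expr2 mulrC ler_pdivlMr ?exprn_gt0.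
Qed.

(** For a basis vector [x] whose image has norm at least [|g|], one gets [c |g|^2 <= |(x g)(x g)| =
    |(x x) g| <= n |g| |x x|]. Dividing by [|g|] gives the bound; the sum [K] removes the dependence
    on [x]. *)
Lemma automorphism_bounded : exists B : R, forall g, automorphism g -> `|g| <= B.
Proof.
have [c c0 cP] := sqr_lower_bound.
pose K : R := \sum_(i < n) `|product (delta_mx 0 i) (delta_mx 0 i)|.
have K0 : 0 <= K by exact: sumr_ge0.
exists (n%:R * K / c) => g [_ gM]; have [g0|g0] := eqVneq `|g| 0.
  by rewrite g0 divr_ge0 ?mulr_ge0 // ltW.
have gp : 0 < `|g| by rewrite lt_neqAle eq_sym g0 normr_ge0.
have [[i j] /= gij] := mx_norm_neq0 g0.
pose x : 'rV[R]_n := delta_mx 0 i.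
have gx : `|g| <= `|x *m g|.
  by rewrite [leLHS]gij (le_trans _ (le_coord_norm _ 0 j)) // -rowE mxE.
have h1 : c * `|g| ^+ 2 <= `|product x x *m g|.
  rewrite gM; apply: le_trans (cP _); apply: ler_wpM2l; first exact: ltW.
  by rewrite ler_sqr ?nnegrE.
have h2 : `|product x x *m g| <= n%:R * `|g| * K.
  apply: le_trans (norm_mulmx_le _ (normr_ge0 g) (le_coord_norm g)) _.
  rewrite ler_wpM2l ?mulr_ge0 // /K (bigD1 i) //= lerDl.
  exact: sumr_ge0.
rewrite ler_pdivlMr // -(ler_pM2l gp).
have -> : `|g| * (`|g| * c) = c * `|g| ^+ 2 by ring.
have -> : `|g| * (n%:R * K) = n%:R * `|g| * K by ring.
exact: le_trans h1 h2.
Qed.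

(** The automorphisms that agree with [g0] at [a] form a coset of the stabilizer. A minimizing
    sequence in it is bounded and the conditions are closed, so an ultralimit attains the
    infimum. *)
Lemma closest_automorphism a g0 : automorphism g0 ->
  exists2 g, automorphism g /\ a *m g = a *m g0 &
    forall h, automorphism h -> a *m h = a -> sqnorm (g - 1%:M) <= sqnorm (h *m g - 1%:M).
Proof.
move=> ag0; have [B gB] := automorphism_bounded.
pose S := [set g | automorphism g /\ a *m g = a *m g0].
pose q (g : 'M[R]_n) := sqnorm (g - 1%:M).
have infq : has_inf (q @` S).
  by split; [exists (q g0), g0|exists 0 => _ [g _ <-]; exact: sqnorm_ge0].
have near_inf (k : nat) : exists g, S g /\ q g < inf (q @` S) + k.+1%:R^-1.
  have k0 : 0 < (k.+1%:R^-1 : R) by rewrite invr_gt0.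
  by have [_ [g Sg <-] ?] := inf_adherent k0 infq; exists g.
have [u uP] := choice near_inf.
have [F [FU Foo]] := @ultraFilterLemma nat (\oo) _.
have [L uL] : exists L, mx_cvg F u L.
  apply: (@ultra_bounded_mx_cvg _ _ _ _ _ u B FU) => k i j.
  exact: le_trans (le_coord_norm _ i j) (gB _ (uP k).1.1).
have aL : automorphism L by apply: automorphism_mx_cvg uL => k; exact: (uP k).1.1.
have aLg : a *m L = a *m g0.
  apply: (mx_cvg_unique (mx_cvgM (mx_cvg_cst F a) uL)).
  rewrite (_ : (fun k => _) = fun=> a *m g0); first exact: mx_cvg_cst.
  by apply/funext => k; exact: (uP k).1.2.
have qL : q L <= inf (q @` S).
  have qu : q (u k) @[k --> F] --> q L.
    by apply: cvg_sqnorm; apply: mx_cvgB => //; exact: mx_cvg_cst.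
  have lim : (inf (q @` S) + k.+1%:R^-1) @[k --> F] --> inf (q @` S) + 0.
    apply: cvgD; first exact: cvg_cst.
    by apply: cvg_trans (@cvg_harmonic R) => A /Foo.
  rewrite -[leRHS]addr0; apply: (ler_cvg_to qu lim).
  by apply: filterE => k; exact/ltW/(uP k).2.
exists L => // h ah aha; apply: le_trans qL _; apply: ge_inf; first exact: infq.2.
by exists (h *m L) => //; split; [exact: automorphismM|rewrite mulmxA aha].
Qed.

(** Since [a *m D = 0], the exponentials of [t D] fix [a] and are admissible as [h]. The squared
    distance from [exp(t D) g] to 1 is thus minimal at [t = 0], and the sum is half its derivative
    there. *)
Lemma closest_stationary a g D : derivation D -> a *m D = 0 ->
  (forall h, automorphism h -> a *m h = a ->
     sqnorm (g - 1%:M) <= sqnorm (h *m g - 1%:M)) ->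
  \sum_i \sum_j (g - 1%:M) i j * (D *m g) i j = 0.
Proof.
move=> dD aD gmin; have [E [E0 dE DE]] := exists_exponential D.
have aE t : a *m E t = a.
  rewrite (@is_derive_mx0_cst _ _ _ (fun s => a *m E s)) ?E0 ?mulmx1 // => s.
  have := is_derive_mxM (is_derive_mx_cst a s) (dE s).
  by rewrite mul0mx add0r mulmxA aD mul0mx.
have autE t : automorphism (E t) by apply: automorphism_exponential dE DE t.
pose G t := E t *m g - 1%:M.
have dG t i j : is_derive t (1 : R) (fun s => G s i j) ((D *m E t *m g) i j).
  have := is_derive_mxM (dE t) (is_derive_mx_cst g t).
  rewrite mulmx0 addr0 => /(_ i j) d1.
  have := @is_deriveB _ _ _ (fun s => (E s *m g) i j)
    (cst ((1%:M : 'M[R]_n) i j)) t (1 : R) _ _ d1 (is_derive_cst _ _ _).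
  rewrite subr0; congr is_derive; apply/funext => s.
  by rewrite /G [RHS]mxE [X in _ = _ + X]mxE.
have dq t : is_derive t (1 : R) (fun s => sqnorm (G s))
    (\sum_i \sum_j (G t i j * (D *m E t *m g) i j + G t i j * (D *m E t *m g) i j)).
  rewrite (_ : (fun s => _) = \sum_(i < n) \sum_(j < n)
     ((fun s => G s i j) * (fun s => G s i j))); last first.
    apply/funext => s; rewrite fct_sumE; apply: eq_bigr => i _.
    by rewrite fct_sumE; apply: eq_bigr => j _; rewrite expr2.
  apply: is_derive_sum => i; apply: is_derive_sum => j.
  exact: is_deriveM.
have : is_derive (0 : R) (1 : R) (fun s => sqnorm (G s)) 0.
  apply: (@derive1_at_min _ _ (- 1) 1).
  - by rewrite (le_trans (lerN10 R)) // ler01.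
  - by move=> t _; exact: (@ex_derive _ _ _ _ _ _ _ (dq t)).
  - by rewrite in_itv /=; rewrite ltrN10 ltr01.
  - by move=> t _; rewrite {1}/G E0 mul1mx; exact: gmin.
move=> /(@derive_val _ _ _ _ _ _ _); rewrite (@derive_val _ _ _ _ _ _ _ (dq 0)).
rewrite /G E0 mulmx1 mul1mx => q0.
suff /eqP : (\sum_i \sum_j (g - 1%:M) i j * (D *m g) i j) *+ 2 = 0.
  by rewrite mulrn_eq0 => /eqP.
rewrite -[RHS]q0 mulr2n -big_split; apply: eq_bigr => i _ /=.
by rewrite -big_split.
Qed.

(* If automorphisms g with [a g - a] in the complement of the tangent space were
   arbitrarily close to fixing [a], those closest to the identity would give in
   the limit of [(g - 1) / |g - 1|] a unit derivation killing [a], contradicting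
   their stationarity along its exponential. *)
Lemma orbit_transversal a p (N : 'M[R]_(n, p)) :
  (forall D, derivation D -> a *m D *m N = 0 -> a *m D = 0) ->
  exists2 e : R, 0 < e & forall y g, y *m N = 0 -> `|y| < e ->
    automorphism g -> a *m g = a + y -> y = 0.
Proof.
move=> trN; apply: contrapT => noe.
(* Each counterexample is replaced by the automorphism closest to 1 with the same value at [a]; it
   differs from 1 because it moves [a]. *)
have bad (k : nat) : exists g, [/\ automorphism g, (a *m g - a) *m N = 0,
    `|a *m g - a| < k.+1%:R^-1, g != 1%:M &
    forall h, automorphism h -> a *m h = a ->
      sqnorm (g - 1%:M) <= sqnorm (h *m g - 1%:M)].
  apply: contrapT => nog; apply: noe; exists k.+1%:R^-1; first by rewrite invr_gt0.
  move=> y g0 yN yk ag0 ay; apply: contrapT => y0; apply: nog.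
  have [g [ag agg0] gmin] := closest_automorphism a ag0; exists g.
  have yE : a *m g - a = y by rewrite agg0 ay addrC addKr.
  split => //; rewrite ?yE //; apply/eqP => g1; apply: y0.
  by rewrite -yE g1 mulmx1 subrr.
have [u uP] := choice bad.
have [B gB] := automorphism_bounded.
have [F [FU Foo]] := @ultraFilterLemma nat (\oo) _.
have [L uL] : exists L, mx_cvg F u L.
  apply: (@ultra_bounded_mx_cvg _ _ _ _ _ u B FU) => k i j.
  by apply: le_trans (le_coord_norm _ i j) (gB _ _); have [] := uP k.
have aL : automorphism L by apply: automorphism_mx_cvg uL => k; have [] := uP k.
have aLa : a *m L = a.
  have lim : mx_cvg F (fun k => a *m u k - a) 0.
    move=> i j; rewrite mxE; apply/cvgr0Pnorm_lt => e e0.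
    have := @cvg_harmonic R; move=> /cvgr0Pnorm_lt /(_ _ e0) /Foo; apply: filterS => k.
    apply: le_lt_trans; apply: le_trans (le_coord_norm _ i j) _.
    have [_ _ lek _ _] := uP k; apply: le_trans (ltW lek) _.
    by rewrite /harmonic /= ger0_norm.
  apply/eqP; rewrite -subr_eq0 eq_sym; apply/eqP/(mx_cvg_unique lim).
  apply: mx_cvgB; last exact: mx_cvg_cst.
  by apply: mx_cvgM => //; exact: mx_cvg_cst.
(* As [L] fixes [a], minimality can be tested with [h = invmx L]: [u k] is no farther from 1 than
   [invmx L *m u k], which tends to 1. *)
have L1 : L = 1%:M.
  apply/eqP; rewrite -subr_eq0; apply/eqP/sqnorm_le0.
  have uL1 := automorphism_unit one0 invP aL.
  have cq : sqnorm (u k - 1%:M) @[k --> F] --> sqnorm (L - 1%:M).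
    by apply: cvg_sqnorm; apply: mx_cvgB => //; exact: mx_cvg_cst.
  have cLq : sqnorm (invmx L *m u k - 1%:M) @[k --> F] --> sqnorm (invmx L *m L - 1%:M).
    apply: cvg_sqnorm; apply: mx_cvgB; last exact: mx_cvg_cst.
    by apply: mx_cvgM => //; exact: mx_cvg_cst.
  have -> : 0 = sqnorm (invmx L *m L - 1%:M).
    rewrite mulVmx // subrr /sqnorm big1 // => i _; rewrite big1 // => j _.
    by rewrite mxE expr0n.
  apply: (ler_cvg_to cq cLq); apply: filterE => k; have [_ _ _ _] := uP k; apply.
    exact: automorphismV aL.
  by rewrite -{1}aLa mulmxK.
pose rho k := Num.sqrt (sqnorm (u k - 1%:M)).
have rho2 k : rho k ^+ 2 = sqnorm (u k - 1%:M) by rewrite sqr_sqrtr // sqnorm_ge0.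
have rho0 k : 0 < rho k.
  rewrite sqrtr_gt0 lt_neqAle sqnorm_ge0 andbT; apply/eqP => q0.
  have [_ _ _ /eqP u1 _] := uP k; apply: u1; apply/eqP; rewrite -subr_eq0.
  by apply/eqP/sqnorm_le0; rewrite -q0.
pose z k := (rho k)^-1 *: (u k - 1%:M).
have zu k : rho k *: z k = u k - 1%:M by rewrite /z scalerA mulfV ?scale1r // gt_eqF.
have z1 k : sqnorm (z k) = 1.
  by rewrite /z sqnormZ exprVn rho2 mulVf // -rho2 expf_neq0 // gt_eqF.
have [Z zZ] : exists Z, mx_cvg F z Z.
  apply: (@ultra_bounded_mx_cvg _ _ _ _ _ z 1 FU) => k i j.
  by rewrite -[leRHS]normr1 -ler_sqr ?nnegrE // !real_normK ?num_real // expr1n -(z1 k)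
    sqr_coord_le_sqnorm.
have Z1 : sqnorm Z = 1.
  exact: cvg_cst_eq z1 (cvg_sqnorm zZ).
have cu1 : mx_cvg F (fun k => u k - 1%:M) 0.
  have -> : 0 = L - 1%:M by rewrite L1 subrr.
  by apply: mx_cvgB => //; exact: mx_cvg_cst.
(* Expanding the multiplicativity of [u k = 1 + rho k *: z k] and dividing by [rho k] leaves the
   Leibniz rule for [z k], up to a term containing [u k - 1], which tends to 0. *)
have dZ : derivation Z.
  move=> x y.
  have cM (w : 'rV[R]_n) (v : nat -> 'M[R]_n) V : mx_cvg F v V ->
      mx_cvg F (fun k => w *m v k) (w *m V).
    by apply: mx_cvgM; exact: mx_cvg_cst.
  have lim : mx_cvg F (fun k => product (x *m z k) y + product x (y *m z k) +
      product (x *m (u k - 1%:M)) (y *m z k))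
    (product (x *m Z) y + product x (y *m Z) + product (x *m 0) (y *m Z)).
    apply: mx_cvgD; last by apply: mx_cvg_product; exact: cM.
    apply: mx_cvgD; apply: mx_cvg_product; by [exact: cM|exact: mx_cvg_cst].
  move: lim; rewrite mulmx0 product0l addr0 => lim.
  apply: (mx_cvg_unique _ lim).
  rewrite (_ : (fun k => _) = fun k => product x y *m z k); first exact: cM.
  apply/funext => k; apply: (@scalerI _ _ (rho k)); first by rewrite gt_eqF.
  have [[_ uM] _ _ _ _] := uP k.
  have zr w : rho k *: (w *m z k) = w *m (u k - 1%:M) by rewrite scalemxAr zu.
  have E w : w *m u k = w + w *m (u k - 1%:M) by rewrite mulmxBr mulmx1 addrC subrK.
  rewrite 2!scalerDr -productZl -!productZr !zr.
  rewrite [product x y *m _]mulmxBr uM !E mulmx1; set p1 := x *m _; set p2 := y *m _.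
  rewrite productDl !productDr; move: (product x y) => v.
  by apply/rowP => i; rewrite !mxE; ring.
have aZ : a *m Z = 0.
  apply: trN => //.
  apply: (mx_cvg_unique (mx_cvgM (mx_cvgM (mx_cvg_cst F a) zZ) (mx_cvg_cst F N))).
  rewrite (_ : (fun k => _) = fun=> 0); first exact: mx_cvg_cst.
  apply/funext => k; have [_ aN _ _ _] := uP k.
  by rewrite /z -scalemxAr -scalemxAl mulmxBr mulmx1 aN scaler0.
(* Stationarity along [Z] makes [z k] orthogonal to [Z *m u k]; in the limit [Z] is orthogonal to
   itself, although its norm is 1. *)
have st k : \sum_i \sum_j z k i j * (Z *m u k) i j = 0.
  have [_ _ _ _ gmin] := uP k.
  have := closest_stationary dZ aZ gmin; rewrite -zu => s0.
  apply: (@mulfI _ (rho k)); first by rewrite gt_eqF.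
  rewrite mulr0 -[RHS]s0 mulr_sumr; apply: eq_bigr => i _; rewrite mulr_sumr.
  by apply: eq_bigr => j _; rewrite mulrA [(rho k *: z k) i j]mxE.
have : \sum_i \sum_j z k i j * (Z *m u k) i j @[k --> F] --> \sum_i \sum_j Z i j * (Z *m L) i j.
  apply: cvg_sum => i; apply: cvg_sum => j; apply: cvgM; first exact: zZ.
  exact: (mx_cvgM (mx_cvg_cst F Z) uL).
move=> /(cvg_cst_eq st); rewrite L1 mulmx1.
have -> : \sum_i \sum_j Z i j * Z i j = sqnorm Z by [].
by rewrite Z1 => /eqP; rewrite oner_eq0.
Qed.

End Compactness.

(** * Slice charts of an orbit *)

Lemma mul_pid_mxE (K : fieldType) n k (w : 'rV[K]_n) i :
  (w *m pid_mx k) 0 i = if (i < k)%N then w 0 i else 0.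
Proof.
rewrite mxE (bigD1 i) //= big1 => [|j ji].
  by rewrite mxE eqxx addr0 /=; case: ltnP; rewrite ?mulr1 ?mulr0.
by rewrite mxE; move: ji; rewrite -val_eqE => /negbTE /= ->; rewrite mulr0.
Qed.

Lemma mul_copid_mxE (K : fieldType) n k (w : 'rV[K]_n) i :
  (w *m copid_mx k) 0 i = if (k <= i)%N then w 0 i else 0.
Proof.
rewrite mulmxBr mulmx1 mxE [X in _ + X]mxE mul_pid_mxE.
by case: leqP => _; rewrite ?subr0 ?subrr.
Qed.

(** [S] is a mere predicate, so a matrix with rows in [S] and maximal rank is taken: adding a vector
    of [S] cannot raise the rank, hence its rows span [S]. [row_ebase] completes a basis of this
    span to one of the whole space. *)
Lemma adapted_basis (K : fieldType) n (S : set 'rV[K]_n) :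
  S 0 -> (forall c u v, S u -> S v -> S (c *: u + v)) ->
  exists (k : nat) (B : 'M[K]_n), [/\ (k <= n)%N, B \in unitmx &
    forall v, S v <-> forall i : 'I_n, (k <= i)%N -> (v *m invmx B) 0 i = 0].
Proof.
move=> S0 Slin.
have Scomb m (c : 'rV[K]_m) (M : 'M[K]_(m, n)) : (forall i, S (row i M)) -> S (c *m M).
  move=> SM; rewrite mulmx_sum_row; elim/big_ind: _ => // [u v Su Sv|i _].
    by rewrite -[u]scale1r; exact: Slin.
  by rewrite -[_ *: _]addr0; exact: Slin.
pose P d := `[< exists2 M : 'M[K]_n, \rank M = d & forall i, S (row i M) >].
have exP : exists d, P d.
  by exists 0%N; apply/asboolP; exists 0 => [|i]; rewrite ?mxrank0 ?row0.
have Pn d : P d -> (d <= n)%N.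
  by move=> /asboolP[M <- _]; exact: rank_leq_row.
case: (ex_maxnP exP Pn) => k /asboolP[M rM SM] kmax.
have SE v : S v <-> (v <= M)%MS.
  split=> [Sv|/submxP[c ->]]; last exact: Scomb.
  have SMv i : S (row i (M + v)%MS).
    have /sub_addsmxP[[c d] /= ->] := row_sub i (M + v)%MS.
    rewrite -[c *m M]scale1r; apply: Slin; first exact: Scomb.
    by apply: Scomb => j; rewrite (_ : row j v = v) //; apply/rowP => q; rewrite mxE ord1.
  have /kmax : P (\rank (M + v)%MS) by apply/asboolP; exists (M + v)%MS.
  rewrite -rM => le1; have := mxrank_leqif_sup (addsmxSl M v).
  move=> [le2 eq]; have := addsmx_sub M v M.
  have -> : (M + v <= M)%MS by rewrite -eq eqn_leq le2.
  by move=> /esym/andP[].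
exists k, (row_ebase M); split.
- by rewrite -rM rank_leq_row.
- exact: row_ebase_unit.
move=> v; rewrite SE submxE /cokermx rM mulmxA.
split=> [/eqP v0 i ki|v0].
  by have := mul_copid_mxE k (v *m invmx (row_ebase M)) i; rewrite v0 ki mxE.
by apply/eqP/rowP => i; rewrite mul_copid_mxE [RHS]mxE; case: leqP => [/v0|].
Qed.

Section OrbitChart.
Variables (R : realType) (n : nat) (C : 'I_n -> 'M[R]_n) (one : 'rV[R]_n).
Local Notation product := (product C).
Local Notation automorphism := (automorphism C one).
Local Notation derivation := (derivation C).

Hypotheses (one0 : one != 0) (oneP : forall x, product one x = x /\ product x one = x).
Hypothesis invP : forall x, x != 0 -> exists y, product x y = one.
Hypothesis sqrP : forall x, product x x = 0 -> x = 0.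

Definition orbit (a x : 'rV[R]_n) := exists2 g, automorphism g & x = a *m g.

Variable a : 'rV[R]_n.

(* [s] is a section, over the orbit of [a], of the map [g |-> a g]. *)
Definition slice_chart (k : nat) (O O' : set 'rV[R]_n) (phi psi : 'rV[R]_n -> 'rV[R]_n)
    (s : 'rV[R]_n -> 'M[R]_n) :=
  [/\ [/\ open O, open O',
          forall j, smooth O (fun x => phi x 0 j),
          forall j, smooth O' (fun x => psi x 0 j) &
          forall i j, smooth O (fun x => s x i j)],
      forall x, O x -> O' (phi x) /\ psi (phi x) = x,
      forall y, O' y -> O (psi y) /\ phi (psi y) = y,
      forall x, O x -> (orbit a x <-> forall i : 'I_n, (k <= i)%N -> phi x 0 i = 0) &
      forall x, O x -> automorphism (s x) /\ (orbit a x -> a *m s x = x)].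

Section ProductOfExponentials.
Variables (D : 'I_n -> 'M[R]_n) (E : 'I_n -> R -> 'M[R]_n).
Hypothesis E0 : forall l, E l 0 = 1%:M.
Hypothesis dE : forall l t, is_derive_mx (E l) t (D l *m E l t).

Definition prod_exp (x : 'rV[R]_n) : 'M[R]_n := \big[mulmx/1%:M]_(l < n) E l (x 0 l).

(** The entries of one exponential serve as generators: by the differential equation, their
    derivatives are linear combinations of entries of the same column. *)
Lemma smooth_exp_coord (O : set 'rV[R]_n) l i j : open O ->
  smooth O (fun x => E l (x 0 l) i j).
Proof.
move=> Oo.
have dEx x v p q : is_derive x v (fun x : 'rV[R]_n => E l (x 0 l) p q)
    (v 0 l * (D l *m E l (x 0 l)) p q) /\
    differentiable (fun x : 'rV[R]_n => E l (x 0 l) p q) x.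
  have dfl : differentiable (fun x : 'rV[R]_n => x 0 l) x by exact: differentiable_coord.
  have dEl : differentiable (fun t => E l t p q) (x 0 l).
    by apply/derivable1_diffP; exact: (@ex_derive _ _ _ _ _ _ _ (dE l (x 0 l) p q)).
  have dc : differentiable ((fun t => E l t p q) \o (fun x : 'rV[R]_n => x 0 l)) x.
    exact: differentiable_comp.
  split => //; split; first exact: diff_derivable.
  rewrite (_ : (fun x => _) = (fun t => E l t p q) \o (fun x : 'rV[R]_n => x 0 l)) //.
  rewrite deriveE // diff_comp //= -(deriveE _ dfl).
  have -> : 'D_v (fun x : 'rV[R]_n => x 0 l) x = v 0 l.
    by rewrite -(@derive_rV R _ _ id) ?derive_id.
  rewrite -[v 0 l]mulr1 [LHS]linearZ -(deriveE _ dEl).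
  by rewrite (@derive_val _ _ _ _ _ _ _ (dE l (x 0 l) p q)) mulr1.
apply: (@smooth_generated _ _ O
  [set (fun x : 'rV[R]_n => E l (x 0 l) p q) | p in setT & q in setT]) => //.
- by move=> _ x [p _ [q _ <-]] _; exact: (dEx x 0 p q).2.
- move=> _ v [p _ [q _ <-]].
  apply: (@generated_eq _ _ _ _ (fun x => \sum_(r < n) cst (v 0 l * D l p r) x *
      E l (x 0 l) r q)).
    move=> x _; have [/(@derive_val _ _ _ _ _ _ _)-> _] := dEx x v p q.
    by rewrite mxE mulr_sumr; apply: eq_bigr => r _; rewrite mulrA.
  apply: generated_sum => r; apply: generatedM; first exact: generated_cst.
  by apply: generated_base; exists r => //; exists q.
by apply: generated_base; exists i => //; exists j.
Qed.

Lemma smooth_prod_exp (O : set 'rV[R]_n) i j : open O ->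
  smooth O (fun x => prod_exp x i j).
Proof.
move=> Oo; rewrite /prod_exp; move: (index_enum _) => r.
elim: r i j => [|l r IH] i j.
  by apply: (smooth_eq Oo _ (smooth_cst ((1%:M : 'M[R]_n) i j) Oo)) => x _; rewrite big_nil.
apply: (@smooth_eq _ _ _
  (fun x => (E l (x 0 l) *m \big[mulmx/1%:M]_(l <- r) E l (x 0 l)) i j)) => //.
  by move=> x _; rewrite big_cons.
by apply: smooth_mulmx => // p q; exact: smooth_exp_coord.
Qed.

(** On a coordinate axis all factors but one are exponentials at time 0; this reduces the Jacobian
    of the chart at 0 to single exponentials. *)
Lemma prod_exp_delta l t : prod_exp (t *: delta_mx 0 l) = E l t.
Proof.
rewrite /prod_exp.
have fE m : E m ((t *: delta_mx 0 l : 'rV[R]_n) 0 m) = if m == l then E l t else 1%:M.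
  by rewrite !mxE /=; case: eqP => [->|_]; rewrite ?mulr1 // mulr0 E0.
under eq_bigr do rewrite fE.
have aux (r : seq 'I_n) : uniq r ->
    \big[mulmx/1%:M]_(m <- r) (if m == l then E l t else 1%:M) =
    if l \in r then E l t else 1%:M.
  elim: r => [|m r IH] /=; first by rewrite big_nil.
  move=> /andP[mr ur]; rewrite big_cons IH // in_cons eq_sym.
  case: eqP => [lm|_] /=; last by rewrite mul1mx.
  by rewrite -lm in mr; rewrite (negPf mr) mulmx1.
by rewrite aux ?mem_index_enum // index_enum_uniq.
Qed.

Lemma automorphism_prod_exp x : (forall l t, automorphism (E l t)) ->
  automorphism (prod_exp x).
Proof.
move=> aE; rewrite /prod_exp; elim/big_ind: _ => // [|g h].
  exact: automorphism1.
exact: automorphismM.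
Qed.

End ProductOfExponentials.

Lemma exists_slice_chart : exists2 k, (k <= n)%N &
  exists (O O' : set 'rV[R]_n) phi psi s, O a /\ slice_chart k O O' phi psi s.
Proof.
have [||k [B [kn uB TE]]] := @adapted_basis R n [set v | exists2 D, derivation D & v = a *m D].
- by exists 0; [exact: derivation0|rewrite mulmx0].
- move=> c _ _ [D dD ->] [D' dD' ->]; exists (c *: D + D').
    exact: derivation_linear.
  by rewrite mulmxDr scalemxAr.
exists k => //.
have exE (i : 'I_n) : exists DE : 'M[R]_n * (R -> 'M[R]_n),
    [/\ a *m DE.1 = if (i < k)%N then row i B else 0,
       DE.2 0 = 1%:M, forall t, is_derive_mx DE.2 t (DE.1 *m DE.2 t) &
       forall t, automorphism (DE.2 t)].
  (* From index [k] on, the zero derivation pads the family: one vector of length [n] then holds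
     both the [k] times and the [n - k] normal coordinates. *)
  have [D dD aD] : exists2 D, derivation D & a *m D = if (i < k)%N then row i B else 0.
    case: ltnP => ik.
      have [_ [j kj|D dD ->]] := TE (row i B); last by exists D.
      rewrite -row_mul mulmxV // !mxE; case: eqP => // ij.
      by move: ik; rewrite ij ltnNge kj.
    by exists 0; [exact: derivation0|rewrite mulmx0].
  have [E [E0 dE DE]] := exists_exponential D.
  exists (D, E); split; [exact: aD|exact: E0|exact: dE|].
  exact: (automorphism_exponential oneP dD E0 dE DE).
have [DE DEP] := choice exE.
pose D i := (DE i).1; pose E i := (DE i).2.
have aD i : a *m D i = if (i < k)%N then row i B else 0 by have [] := DEP i.
have E0 i : E i 0 = 1%:M by have [] := DEP i.
have dE i t : is_derive_mx (E i) t (D i *m E i t) by have [_ _ + _] := DEP i; exact.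
have aE i t : automorphism (E i t) by have [_ _ _] := DEP i; exact.
(* [v *m N] reads the tangent coordinates of [v] in the basis [B]; its kernel, spanned by the last
   [n - k] rows of [B], is the chosen complement, parametrized by [Y] below. *)
pose N := invmx B *m (pid_mx k : 'M[R]_n).
have [e e0 eP] : exists2 e : R, 0 < e & forall y g, y *m N = 0 -> `|y| < e ->
    automorphism g -> a *m g = a + y -> y = 0.
  apply: (orbit_transversal one0 oneP invP sqrP) => F dF aFN.
  have [/(_ (ex_intro2 _ _ F dF erefl)) c0 _] := TE (a *m F).
  have : a *m F *m invmx B = 0.
    apply/rowP => i; rewrite [RHS]mxE; have [/c0//|ik] := leqP k i.
    by move: aFN => /rowP/(_ i); rewrite /N mulmxA mul_pid_mxE ik [RHS]mxE.
  by move=> /(congr1 (mulmx^~ B)); rewrite mulmxKV // mul0mx.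
pose Y := copid_mx k *m B.
have YN (x : 'rV[R]_n) : x *m Y *m N = 0.
  by rewrite /Y /N !mulmxA mulmxK // -[x *m _ *m _]mulmxA mul_copid_mx_pid // mulmx0.
pose g := prod_exp E.
pose Psi x := (a + x *m Y) *m g x.
pose O := [set x : 'rV[R]_n | `|x *m Y| < e].
have Oo : open O.
  rewrite (_ : O = (mulmxr Y) @^-1` (ball 0 e)).
    by apply: open_comp; [move=> x _; exact: mulmx_continuous|exact: ball_open].
  by apply/seteqP; split => x /=; rewrite -ball_normE /= sub0r normrN.
have O0 : O 0 by rewrite /O /= mul0mx normr0.
have sPsi (U : set 'rV[R]_n) j : open U -> smooth U (fun x => Psi x 0 j).
  move=> Uo; apply: smooth_mulmx => // [i l|i l]; last exact: (smooth_prod_exp dE).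
  apply: (@smooth_eq _ _ _ (fun x => a i l + (x *m Y) i l)) => //.
    by move=> x _; rewrite [RHS]mxE.
  apply: smoothD => //; first exact: smooth_cst.
  apply: smooth_mulmx => // [p q|p q]; last exact: smooth_cst.
  by rewrite ord1; exact: smooth_coord.
have dPsi x : differentiable Psi x.
  apply: (@smooth_rV_differentiable _ _ _ setT) => // j; apply: sPsi; exact: openT.
(* Along axis [i] the velocity is [a *m D i] if [i < k] and the normal vector otherwise: row [i] of
   [B] in both cases. *)
have JPsi : 'J Psi 0 = B.
  apply/matrixP => i j; rewrite jacobian_coord //.
  pose F (t : R) := Psi (t *: delta_mx 0 i + 0).
  have d1 : is_derive (0 : R) (1 : R) (fun t => F t 0 j)
      ('D_(delta_mx 0 i) (fun x => Psi x 0 j) 0).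
    have := @is_derive_line _ _ (fun x => Psi x 0 j) 0 (delta_mx 0 i) 0.
    rewrite scale0r addr0; apply.
    by apply: diff_derivable; exact: differentiable_rV_coord.
  have FE : F = fun t => (a + t *: (delta_mx 0 i *m Y)) *m E i t.
    by apply/funext => t; rewrite /F /Psi addr0 /g prod_exp_delta // scalemxAl.
  have dlin : is_derive_mx (fun t => a + t *: (delta_mx 0 i *m Y)) 0 (delta_mx 0 i *m Y).
    move=> p q; rewrite (_ : (fun s => _) = cst (a p q) + 
      (id \* cst ((delta_mx 0 i *m Y) p q))); last first.
      by apply/funext => s; rewrite mxE [X in _ + X]mxE.
    have d2 := @is_deriveM _ _ id (cst ((delta_mx 0 i *m Y) p q)) (0 : R) 1 _ _
      (is_derive_id _ _) (is_derive_cst _ _ _).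
    have d3 := @is_deriveD _ _ _ _ _ (0 : R) (1 : R) _ _ (is_derive_cst (a p q) _ _) d2.
    apply: is_derive_eq d3 _.
    by rewrite add0r scaler0 add0r /GRing.scale /= mulr1.
  have := is_derive_mxM dlin (dE i 0); rewrite -FE => /(_ 0 j) d4.
  rewrite -(@derive_val _ _ _ _ _ _ _ d1) (@derive_val _ _ _ _ _ _ _ d4).
  rewrite E0 !mulmx1 scale0r addr0 aD.
  suff -> : delta_mx 0 i *m Y = if (k <= i)%N then row i B else 0.
    by case: ltnP => _; rewrite ?add0r ?addr0 mxE.
  rewrite /Y mulmxA; case: leqP => ki; last first.
    rewrite (_ : _ *m copid_mx k = 0) ?mul0mx //; apply/rowP => l.
    rewrite mul_copid_mxE !mxE eqxx /=; case: leqP => // kl.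
    by case: eqP => // li; move: ki; rewrite -li ltnNge kl.
  rewrite rowE; congr (_ *m B); apply/rowP => l.
  rewrite mul_copid_mxE !mxE eqxx /=; case: leqP => // lk.
  by case: eqP => // li; move: ki; rewrite -li leqNgt lk.
have := @inverse_function R n O Psi 0 Oo O0 (fun j => sPsi O j Oo).
rewrite JPsi => /(_ uB)[W [W' [h [[Wo W'o W0 WO] hW fW sh]]]].
have ag x : automorphism (g x) by exact: automorphism_prod_exp.
have ug x : g x \in unitmx by refine (automorphism_unit one0 invP (ag x)).
have YE (x : 'rV[R]_n) : (forall i : 'I_n, (k <= i)%N -> x 0 i = 0) <-> x *m Y = 0.
  rewrite /Y mulmxA; split=> [x0|].
    rewrite (_ : _ *m copid_mx k = 0) ?mul0mx //; apply/rowP => l.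
    by rewrite mul_copid_mxE [RHS]mxE; case: leqP => [/x0|].
  move=> /(congr1 (mulmx^~ (invmx B))); rewrite mulmxK // mul0mx => x0 i ki.
  by have := mul_copid_mxE k x i; rewrite x0 ki mxE.
(* If [a *m f = (a + y) *m g], then [f] followed by the inverse of [g] sends [a] to [a + y], with
   [y] in the complement and small by the choice of [O]; transversality gives [y = 0]. *)
have orbE x : W' x -> (orbit a x <-> h x *m Y = 0).
  move=> W'x; have [Wh hE] := fW x W'x; split=> [[f af xE]|hY].
    apply: (eP _ (f *m invmx (g (h x)))) => //.
    - exact: WO.
    - by apply: automorphismM => //; exact: automorphismV.
    - by rewrite mulmxA -xE -{1}hE /Psi mulmxK.
  by exists (g (h x)) => //; rewrite -{1}hE /Psi hY addr0.
exists W', W, h, Psi, (g \o h); split.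
  have [W'a _] := hW 0 W0; suff <- : Psi 0 = a by [].
  rewrite /Psi mul0mx addr0.
  (* [prod_exp_delta] needs an index; without one, [n = 0] and all row vectors coincide. *)
  have [i _|noI] := pickP (@predT 'I_n); last by apply/rowP => i; have := noI i.
  by have := prod_exp_delta E0 i 0; rewrite scale0r E0 /g => ->; rewrite mulmx1.
split => //.
- split => // [j|i j]; first exact: sPsi.
  apply: (@smooth_comp _ _ _ W' W h W'o _ (fun x => g x i j)) => //.
    by move=> x /fW[].
  exact: (smooth_prod_exp dE).
- by move=> x W'x; apply: iff_trans (orbE x W'x) (iff_sym (YE _)).
- move=> x W'x; split => [|/(orbE x W'x) hY]; first exact: ag.
  by have [_ hE] := fW x W'x; rewrite -[RHS]hE /Psi hY addr0.
Qed.

(** Automorphisms preserve the orbit, so one chart yields charts at all its points with the same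
    [k]; the section gains a factor [g] to reach the translated point. *)
Lemma slice_chart_translate k O O' phi psi s g : automorphism g ->
  slice_chart k O O' phi psi s ->
  slice_chart k (mulmxr (invmx g) @^-1` O) O' (phi \o mulmxr (invmx g))
    (mulmxr g \o psi) (fun x => s (x *m invmx g) *m g).
Proof.
move=> ag [[Oo O'o sphi spsi ss] phiK psiK orbE sP].
have ug : g \in unitmx by refine (automorphism_unit one0 invP ag).
have smulr (P : set 'rV[R]_n) (M : 'M[R]_n) j : open P ->
    smooth P (fun x => mulmxr M x 0 j).
  move=> Po; apply: smooth_mulmx => // [i l|i l]; last exact: smooth_cst.
  by rewrite ord1; exact: smooth_coord.
have Po : open (mulmxr (invmx g) @^-1` O).
  by apply: open_comp Oo => x _; exact: mulmx_continuous.
have orbV x : orbit a (x *m invmx g) <-> orbit a x.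
  split=> [] [h ah hE].
    exists (h *m g); first exact: automorphismM.
    by rewrite mulmxA -hE mulmxKV.
  exists (h *m invmx g); last by rewrite mulmxA -hE.
  by apply: automorphismM => //; exact: (automorphismV one0 invP).
split.
- split=> //.
  + move=> j; apply: (@smooth_comp _ _ _ _ O (mulmxr (invmx g)) Po _ (fun x => phi x 0 j)) => // i.
    exact: smulr.
  + move=> j; apply: (@smooth_comp _ _ _ O' setT psi O'o _ (fun y => mulmxr g y 0 j)) => //.
    by apply: smulr; exact: openT.
  + move=> i j; apply: smooth_mulmx => // [p q|p q]; last exact: smooth_cst.
    apply: (@smooth_comp _ _ _ _ O (mulmxr (invmx g)) Po _ (fun x => s x p q)) => // l.
    exact: smulr.
- move=> x /= Ox; have [phix E] := phiK _ Ox; split => //=.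
  by rewrite E mulmxKV.
- by move=> y O'y; have [psiy E] := psiK _ O'y; rewrite /= mulmxK.
- by move=> x Ox; apply: iff_trans (iff_sym (orbV x)) (orbE _ Ox).
- move=> x Ox; have [autx asE] := sP _ Ox; split; first exact: automorphismM.
  by move=> /orbV/asE E; rewrite mulmxA E mulmxKV.
Qed.

Theorem exists_slice_charts : exists2 k, (k <= n)%N & forall p, orbit a p ->
  exists (O O' : set 'rV[R]_n) phi psi s, O p /\ slice_chart k O O' phi psi s.
Proof.
have [k kn [U [U' [phi [psi [s [Ua chart]]]]]]] := exists_slice_chart.
exists k => // _ [g ag ->].
have ug : g \in unitmx by refine (automorphism_unit one0 invP ag).
exists (mulmxr (invmx g) @^-1` U), U', (phi \o mulmxr (invmx g)),
  (mulmxr g \o psi), (fun x => s (x *m invmx g) *m g).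
by split; [rewrite /= mulmxK|exact: slice_chart_translate].
Qed.

End OrbitChart.

(** * Transfer to abstract vector spaces *)

Section Coordinates.
Variable R : realType.
Implicit Types V W : vectType R.

Lemma of_coordsK V : cancel (@of_coords R V) (@to_coords R V).
Proof. exact/passmx.vecofK/vbasisP. Qed.

Lemma to_coordsK V : cancel (@to_coords R V) (@of_coords R V).
Proof. exact/passmx.rVofK/vbasisP. Qed.

HB.instance Definition _ V := GRing.isSemilinear.Build R _ _ _ (@to_coords R V)
  (GRing.semilinear_linear (passmx.rVof_linear _)).
HB.instance Definition _ V := GRing.isSemilinear.Build R _ _ _ (@of_coords R V)
  (GRing.semilinear_linear (passmx.vecof_linear _)).

Section IterDerive.
Variables (m n : nat) (O : set 'rV[R]_m) (F : 'rV[R]_m -> 'rV[R]_n).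
Hypothesis Oo : open O.

(** Coordinates commute with ['D_v] only where the function is differentiable. Assuming this for
    strictly shorter lists matches the induction hypothesis available in [iter_derive_smoothP]. *)
Lemma iter_derive_coord vs :
  (forall ws x, O x -> (size ws < size vs)%N -> differentiable (iter_derive ws F) x) ->
  forall x j, O x -> iter_derive vs F x 0 j = iter_derivative vs (fun y => F y 0 j) x.
Proof.
elim: vs => //= v vs IH dF x j Ox.
rewrite -/(iter_derive vs F) derive_rV; last by apply: dF => //; rewrite ltnS.
apply: near_eq_derive; apply: (open_near_eq Oo Ox) => y Oy; apply: IH => // ws z Oz sz.
by apply: dF => //; rewrite ltnS ltnW.
Qed.

Lemma iter_derive_smoothP :
  (forall vs x, O x -> differentiable (iter_derive vs F) x) <->
  (forall j, smooth O (fun x => F x 0 j)).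
Proof.
split=> [dF j vs x Ox|sF vs].
  apply: (@near_eq_differentiable _ _ _ (fun y => iter_derive vs F y 0 j)).
    by apply: (open_near_eq Oo Ox) => y Oy; apply: iter_derive_coord => // *; exact: dF.
  exact/differentiable_rV_coord/dF.
have [k] := ubnP (size vs); elim: k vs => // k IH vs; rewrite ltnS => sk x Ox.
apply: differentiable_rV => j.
apply: (@near_eq_differentiable _ _ _ (iter_derivative vs (fun y => F y 0 j))).
  apply: (open_near_eq Oo Ox) => y Oy; rewrite iter_derive_coord // => ws z Oz sz.
  by apply: IH => //; exact: leq_trans sz sk.
exact: sF.
Qed.

End IterDerive.

Lemma smooth_onP V W (U : set V) (f : V -> W) : vopen U ->
  smooth_on U f <->
  forall j, smooth (@of_coords R V @^-1` U) (fun x => to_coords (f (of_coords x)) 0 j).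
Proof.
move=> Uo; exact: (iter_derive_smoothP (@to_coords R W \o f \o @of_coords R V) Uo).
Qed.

Lemma open_preimage m n (O : set 'rV[R]_m) (P : set 'rV[R]_n) (F : 'rV[R]_m -> 'rV[R]_n) :
  open O -> open P -> (forall j, smooth O (fun x => F x 0 j)) ->
  open (O `&` F @^-1` P).
Proof.
move=> Oo Po sF; rewrite openE => x [Ox Px]; apply: filterI.
  exact: open_nbhs_nbhs.
apply: (differentiable_continuous (smooth_rV_differentiable sF Ox)).
exact: open_nbhs_nbhs.
Qed.

Lemma vopenT V : vopen [set: V].
Proof. by rewrite /vopen preimage_setT; exact: openT. Qed.

Lemma smooth_linear_coord m n (O : set 'rV[R]_m) (f : {linear 'rV[R]_m -> 'rV[R]_n}) j :
  open O -> smooth O (fun x => f x 0 j).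
Proof.
move=> Oo; apply: (@smooth_eq _ _ _ (fun x => (x *m lin1_mx f) 0 j)) => //.
  by move=> x _; rewrite mul_rV_lin1.
apply: smooth_mulmx => // [i l|i l]; last exact: smooth_cst.
by rewrite ord1; exact: smooth_coord.
Qed.

Lemma smooth_on_linear V W (U : set V) (f : {linear V -> W}) : vopen U -> smooth_on U f.
Proof.
move=> Uo; apply/smooth_onP => // j.
exact: (smooth_linear_coord (@to_coords R W \o f \o @of_coords R V)).
Qed.

Lemma smooth_on_comp V W (X : vectType R) (U : set V) (U' : set W) (f : V -> W) (g : W -> X) :
  vopen U -> vopen U' -> (forall x, U x -> U' (f x)) ->
  smooth_on U f -> smooth_on U' g -> smooth_on U (g \o f).
Proof.
move=> Uo U'o fUU' /(smooth_onP _ Uo) sf /(smooth_onP _ U'o) sg.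
apply/smooth_onP => // j; apply: (@smooth_eq _ _ _
  ((fun y => to_coords (g (of_coords y)) 0 j) \o
   (fun x => to_coords (f (of_coords x))))) => //.
  by move=> x _; rewrite /= to_coordsK.
apply: (@smooth_comp _ _ _ _ (@of_coords R W @^-1` U')) => // x Ux.
by rewrite /= to_coordsK; exact: fUU'.
Qed.

Lemma vopen_preimage V W (U : set V) (U' : set W) (f : V -> W) :
  vopen U -> vopen U' -> smooth_on U f -> vopen (U `&` f @^-1` U').
Proof.
move=> Uo U'o /(smooth_onP _ Uo) sf.
have := open_preimage Uo U'o sf; rewrite /vopen; congr open.
by apply/seteqP; split => x [Ux] /=; rewrite to_coordsK; split.
Qed.

(** As an abstract space, ['rV[R]_n] is read in its own [vbasis], not in the standard basis; a
    linear change of coordinates links the two. *)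
Lemma smooth_on_to_rV V n (U : set V) (f : V -> 'rV[R]_n) : vopen U ->
  (forall j, smooth (@of_coords R V @^-1` U) (fun x => f (of_coords x) 0 j)) ->
  smooth_on U f.
Proof.
move=> Uo sf; apply/smooth_onP => // j.
apply: (@smooth_comp _ _ _ _ setT (f \o @of_coords R V) Uo _ (fun y => to_coords y 0 j)) => //.
by apply: smooth_linear_coord; exact: openT.
Qed.

Lemma smooth_on_from_rV W n (U : set 'rV[R]_n) (f : 'rV[R]_n -> W) : open U ->
  (forall j, smooth U (fun x => to_coords (f x) 0 j)) -> vopen U /\ smooth_on U f.
Proof.
move=> Uo sf; have Uv : vopen U.
  by apply: open_comp Uo => x _; exact: linear_rV_continuous.
split => //; apply/smooth_onP => // j.
apply: (@smooth_comp _ _ _ _ U (@of_coords R _) Uv _ (fun y => to_coords (f y) 0 j)) => // l.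
exact: smooth_linear_coord.
Qed.

Lemma smooth_on_mx V W m n (U : set V) (s : V -> 'M[R]_(m, n)) (f : {linear 'M[R]_(m, n) -> W}) :
  vopen U -> (forall i j, smooth (@of_coords R V @^-1` U) (fun x => s (of_coords x) i j)) ->
  smooth_on U (f \o s).
Proof.
move=> Uo ss; apply/smooth_onP => // l; apply: (@smooth_eq _ _ _ (fun x =>
  \sum_i \sum_j s (of_coords x) i j * to_coords (f (delta_mx i j)) 0 l)) => //.
  move=> x _; rewrite /= [s _ in RHS]matrix_sum_delta !linear_sum summxE.
  apply: eq_bigr => i _; rewrite !linear_sum summxE; apply: eq_bigr => j _.
  by rewrite !linearZ [RHS]mxE.
apply: smooth_sum => // i; apply: smooth_sum => // j; apply: smoothM => //.
exact: smooth_cst.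
Qed.

End Coordinates.

Section EvalAt.
Variables (R : realType) (A : vectType R) (x : A).
(** Named so as to carry a linear structure: the orbit map is the restriction of [eval_at alpha] to
    the group. *)
Definition eval_at (g : 'End(A)) : A := g x.
Lemma eval_at_linear : linear eval_at.
Proof. by move=> c g h; rewrite /eval_at !lfunE /= lfunE. Qed.
HB.instance Definition _ := GRing.isSemilinear.Build R _ _ _ eval_at
  (GRing.semilinear_linear eval_at_linear).
End EvalAt.

Section EndOfMatrix.
Variables (R : realType) (A : vectType R).
Definition end_of (M : 'M[R]_(\dim {:A})) : 'End(A) :=
  passmx.hommx (vbasis {:A}) (vbasis {:A}) M.
HB.instance Definition _ := GRing.isSemilinear.Build R _ _ _ end_of
  (GRing.semilinear_linear (@passmx.hommx_linear _ _ _ _ _)).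
End EndOfMatrix.
Arguments end_of {R A} M.

(** * The orbit of [alpha] in the abstract algebra *)

Section Orbit.
Variables (R : realType) (A : vectType R) (mul : {bilinear A -> A -> A}) (one : A).
Hypothesis hdiv : is_division_algebra mul one.
Variable alpha : A.

Local Notation n := (\dim {:A}).
Local Notation basis := (vbasis {:A}).
Local Notation tc := (@to_coords R A).
Local Notation oc := (@of_coords R A).

Definition structure_mx (p : 'I_n) : 'M[R]_n :=
  \matrix_q tc (mul (oc (delta_mx 0 p)) (oc (delta_mx 0 q))).
Local Notation C := structure_mx.
Local Notation aut_mx := (automorphism C (tc one)).
Local Notation mx_of := (passmx.mxof basis basis).

Lemma product_coords u v : product C u v = tc (mul (oc u) (oc v)).
Proof.
have ocE w : oc w = \sum_p w 0 p *: oc (delta_mx 0 p).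
  by rewrite [w in LHS]row_sum_delta linear_sum; apply: eq_bigr => p _; rewrite linearZ.
rewrite /product mulmx_sum_row [oc u]ocE linear_sumlz linear_sum.
apply: eq_bigr => p _; rewrite linearZl_LR linearZ; congr (_ *: _).
rewrite rowK mulmx_sum_row [oc v]ocE linear_sumr linear_sum.
apply: eq_bigr => q _; rewrite linearZr_LR linearZ; congr (_ *: _).
by rewrite rowK.
Qed.

Lemma app_coords (g : 'End(A)) x : tc (g x) = tc x *m mx_of g.
Proof. exact: (passmx.rVof_app _ (vbasisP _)). Qed.

Lemma end_ofK : cancel (@end_of R A) mx_of.
Proof. exact: (passmx.hommxK (vbasisP _) (vbasisP _)). Qed.

Lemma end_of_coords (M : 'M[R]_n) x : tc (end_of M x) = tc x *m M.
Proof. by rewrite app_coords end_ofK. Qed.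

Lemma mul_coords x y : tc (mul x y) = product C (tc x) (tc y).
Proof. by rewrite product_coords !to_coordsK. Qed.

Let tc_inj : injective tc. Proof. exact: can_inj (@to_coordsK R A). Qed.

Lemma coords_one_neq0 : tc one != 0.
Proof. by have [_ one0 _] := hdiv; rewrite -(linear0 tc) (inj_eq tc_inj). Qed.

Lemma coords_oneP x : product C (tc one) x = x /\ product C x (tc one) = x.
Proof.
have [oneP _ _] := hdiv; rewrite !product_coords !to_coordsK.
by have [-> ->] := oneP (oc x); rewrite of_coordsK.
Qed.

Lemma coords_invP x : x != 0 -> exists y, product C x y = tc one.
Proof.
move=> x0; have [_ _ div] := hdiv.
have ox : oc x != 0 by rewrite -(inj_eq tc_inj) of_coordsK linear0.
have [[k _ kK] _] := div _ ox.
by exists (tc (k one)); rewrite product_coords to_coordsK kK.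
Qed.

Lemma coords_sqrP x : product C x x = 0 -> x = 0.
Proof.
have [_ _ div] := hdiv => xx; apply/eqP/negPn/negP => x0.
have ox : oc x != 0 by rewrite -(inj_eq tc_inj) of_coordsK linear0.
have [/bij_inj inj _] := div _ ox.
move: xx; rewrite product_coords -(linear0 tc) => /tc_inj.
have e0 : mul (oc x) 0 = 0 by rewrite linear0r.
rewrite -[RHS]e0 => /inj/eqP.
by rewrite (negPf ox).
Qed.

(** [g one] is a nonzero idempotent; cancelling it in [g one * g one = g one * one] leaves the
    claim. *)
Lemma automorphisms_one (g : 'End(A)) : automorphisms mul g -> g one = one.
Proof.
move=> [/bij_inj gi gM]; have [oneP one0 div] := hdiv.
have g1 : g one != 0 by rewrite -(linear0 g) (inj_eq gi).
have [/bij_inj inj _] := div _ g1.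
by apply: inj; rewrite -gM (proj1 (oneP _)) (proj2 (oneP _)).
Qed.

Lemma automorphismsP (g : 'End(A)) : automorphisms mul g <-> aut_mx (mx_of g).
Proof.
split=> [ag|ag].
  split; first by rewrite -app_coords automorphisms_one.
  move=> x y; have [_ gM] := ag.
  by rewrite -[x]of_coordsK -[y]of_coordsK -mul_coords -!app_coords gM mul_coords.
split; last first.
  by move=> x y; apply: tc_inj; rewrite app_coords !mul_coords (ag.2 _ _) -!app_coords.
have ug : mx_of g \in unitmx by refine (automorphism_unit coords_one_neq0 coords_invP ag).
exists (end_of (invmx (mx_of g))) => x; apply: tc_inj.
  by rewrite end_of_coords app_coords mulmxK.
by rewrite app_coords end_of_coords mulmxKV.
Qed.

Lemma end_of_automorphism M : aut_mx M -> automorphisms mul (end_of M).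
Proof. by move=> aM; apply/automorphismsP; rewrite end_ofK. Qed.

Definition aut_orbit : set A := [set eval_at alpha g | g in automorphisms mul].

Lemma aut_orbitP x : aut_orbit x <-> orbit C (tc one) (tc alpha) (tc x).
Proof.
split=> [[g /automorphismsP ag <-]|[g ag gE]].
  by exists (mx_of g) => //; rewrite -app_coords.
exists (end_of g); first exact: end_of_automorphism.
by apply: tc_inj; rewrite /eval_at end_of_coords.
Qed.

Let charts := exists_slice_charts coords_one_neq0 coords_oneP coords_invP coords_sqrP (tc alpha).

Lemma embedded_aut_orbit : embedded_submanifold aut_orbit.
Proof.
have [k kn chartP] := charts; exists k => // p /aut_orbitP/chartP.
move=> [P [P' [phi [psi [s [Pp [[Po P'o sphi spsi _] phiK psiK orbE _]]]]]]].
pose U := tc @^-1` P.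
have UE : oc @^-1` U = P by apply/seteqP; split=> x; rewrite /U /= of_coordsK.
have Uo : vopen U by rewrite /vopen UE.
have [P'v so] := @smooth_on_from_rV R A n P' (oc \o psi) P'o
  (fun j => smooth_eq P'o (fun x _ =>
     esym (congr1 (fun v : 'rV_n => v 0 j) (of_coordsK (psi x)))) (spsi j)).
exists U, P', (phi \o tc), (oc \o psi); split => //.
- split => //; apply: smooth_on_to_rV => // j; rewrite UE.
  by apply: (smooth_eq Po _ (sphi j)) => x _; rewrite /= of_coordsK.
- by move=> x /phiK[P'x E]; split => //=; rewrite E to_coordsK.
- by move=> y /psiK[Py E]; rewrite /U /= of_coordsK.
- by move=> x Ux; apply: iff_trans (aut_orbitP x) (orbE _ Ux).
Qed.

Lemma aut_orbit_section p : aut_orbit p -> exists (U : set A) (s : A -> 'End(A)),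
  [/\ vopen U, U p, smooth_on U s &
      forall x, U x -> automorphisms mul (s x) /\ (aut_orbit x -> s x alpha = x)].
Proof.
have [k kn chartP] := charts => /aut_orbitP/chartP.
move=> [P [P' [phi [psi [s [Pp [[Po _ _ _ ss] _ _ _ sP]]]]]]].
pose U := tc @^-1` P.
have UE : oc @^-1` U = P by apply/seteqP; split=> x; rewrite /U /= of_coordsK.
have Uo : vopen U by rewrite /vopen UE.
exists U, (end_of \o (s \o tc)); split => //.
- apply: smooth_on_mx => // i j; rewrite UE.
  by apply: (smooth_eq Po _ (ss i j)) => x _; rewrite /= of_coordsK.
- move=> x Ux; have [sa sE] := sP _ Ux; split; first exact: end_of_automorphism.
  by move=> /aut_orbitP /sE E; apply: tc_inj; rewrite end_of_coords.
Qed.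

(** * Cosets of the stabilizer and points of the orbit *)

Local Notation G := (automorphisms mul).
Local Notation H := (stabilizer mul alpha).
Local Notation GH := (@cosets R A G H).
Local Notation proj := (@coset_proj R A G H).

Lemma automorphisms_comp g h : G g -> G h -> G (g \o h)%VF.
Proof.
move=> [gb gM] [hb hM]; split.
  by apply: (eq_bij (bij_comp gb hb)) => x; rewrite comp_lfunE.
by move=> x y; rewrite !comp_lfunE /= hM gM.
Qed.

Lemma automorphisms_inv g : G g -> exists2 h : 'End(A), G h & cancel g h /\ cancel h g.
Proof.
move=> [gb gM]; have k0 : lker g == 0%VS by apply/lker0P; exact: bij_inj.
have gK := lker0_lfunK k0; have Kg := lker0_lfunVK k0.
exists (g^-1)%VF => //; split; first by exists g.
by move=> x y; apply: (bij_inj gb); rewrite gM !Kg.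
Qed.

(** If [f alpha = f' alpha], then [f h] equals [f'] composed with the inverse of [f'], [f] and [h],
    and the last three together fix [alpha]. *)
Lemma left_coset_eqP g g' : G g -> G g' ->
  left_coset H g = left_coset H g' <-> g alpha = g' alpha.
Proof.
have sub f f' : G f -> G f' -> f alpha = f' alpha ->
    left_coset H f `<=` left_coset H f'.
  move=> Gf Gf' ff' _ [h [Gh ha] <-].
  have [k Gk [f'K Kf']] := automorphisms_inv Gf'.
  exists (k \o (f \o h))%VF; last by apply/lfunP => x; rewrite !comp_lfunE /= Kf'.
  split; first by do ?[apply: automorphisms_comp].
  by rewrite !comp_lfunE /= ha ff' f'K.
move=> Gg Gg'; split=> [E|E]; last by apply/seteqP; split; exact: sub.
have : left_coset H g g.
  exists \1%VF; last by rewrite comp_lfun1r.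
  split; last by rewrite id_lfunE.
  split; first by exists id => x; rewrite id_lfunE.
  by move=> x y; rewrite !id_lfunE.
by rewrite E => -[h [_ ha] <-]; rewrite comp_lfunE /= ha.
Qed.

(** An arbitrary choice with no regularity in [c], harmless because the value at [alpha] depends
    only on the coset. *)
Definition coset_repr (c : GH) : 'End(A) := s2val (cid2 (set_valP c)).

Lemma coset_repr_aut c : G (coset_repr c).
Proof. exact: (s2valP (cid2 (set_valP c))). Qed.

Lemma coset_reprE c : left_coset H (coset_repr c) = set_val c.
Proof. exact: (s2valP' (cid2 (set_valP c))). Qed.

Definition orbit_of_coset (c : GH) : aut_orbit :=
  SigSub (mem_set (ex_intro2 _ _ (coset_repr c) (coset_repr_aut c) erefl)).

Definition orbit_repr (x : aut_orbit) : 'End(A) := s2val (cid2 (set_valP x)).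

Lemma orbit_repr_aut x : G (orbit_repr x).
Proof. exact: (s2valP (cid2 (set_valP x))). Qed.

Lemma orbit_reprE x : orbit_repr x alpha = set_val x.
Proof. exact: (s2valP' (cid2 (set_valP x))). Qed.

Definition aut_elt g (Gg : G g) : set_type G := SigSub (mem_set Gg).

Definition coset_of_orbit (x : aut_orbit) : GH :=
  proj (aut_elt (orbit_repr_aut x)).

(** Frees the map from the representative chosen in its definition, so that near a point the smooth
    section can replace it. *)
Lemma coset_of_orbitE x g (Gg : G g) : g alpha = set_val x ->
  coset_of_orbit x = proj (aut_elt Gg).
Proof.
move=> gx; apply: val_inj; apply/left_coset_eqP => //; first exact: orbit_repr_aut.
by rewrite orbit_reprE.
Qed.

Lemma orbit_of_coset_proj (g : set_type G) :
  set_val (orbit_of_coset (proj g)) = (set_val g) alpha.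
Proof.
apply/left_coset_eqP; [exact: coset_repr_aut|exact: set_valP|].
exact: coset_reprE.
Qed.

Lemma orbit_of_cosetK : cancel orbit_of_coset coset_of_orbit.
Proof.
move=> c; rewrite (@coset_of_orbitE _ _ (coset_repr_aut c)) //.
by apply: val_inj; exact: coset_reprE.
Qed.

Lemma coset_of_orbitK : cancel coset_of_orbit orbit_of_coset.
Proof. by move=> x; apply: val_inj; rewrite [LHS]orbit_of_coset_proj; exact: orbit_reprE. Qed.

(** The quotient structure only tests the composite with the projection, which is the restriction of
    the linear map [eval_at alpha]. *)
Lemma smooth_orbit_of_coset :
  smooth_map (X := homogeneous_space G H) (Y := induced_space aut_orbit) orbit_of_coset.
Proof.
have evalU (U : set A) : vopen U -> vopen (eval_at alpha @^-1` U).
  move=> Uo; rewrite -[X in vopen X]setTI; apply: vopen_preimage => //.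
    exact: vopenT.
  by apply: smooth_on_linear; exact: vopenT.
move=> V [U Uo VE]; split.
  exists (eval_at alpha @^-1` U); first exact: evalU.
  by apply/seteqP; split => g; rewrite VE /preimage /= orbit_of_coset_proj.
move=> f sf g Vg; have [W [F [Wo Wp sF fF]]] := sf _ Vg.
exists (eval_at alpha @^-1` W), (F \o eval_at alpha); split.
- exact: evalU.
- by move: Wp; rewrite /preimage /= orbit_of_coset_proj.
- apply: (smooth_on_comp _ Wo _ _ sF) => //; first exact: evalU.
  by apply: smooth_on_linear; exact: evalU.
- move=> q Vq Wq; rewrite /= (fF _ Vq) ?orbit_of_coset_proj //.
Qed.

(** Locally the map is the section [s] followed by the projection, so open sets and smooth functions
    on the group side are pulled back along [s]. *)
Lemma smooth_coset_of_orbit :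
  smooth_map (X := induced_space aut_orbit) (Y := homogeneous_space G H) coset_of_orbit.
Proof.
move=> V [U Uo VE].
have VU g (Gg : G g) : V (proj (aut_elt Gg)) <-> U g.
  by rewrite -[V _]/((proj @^-1` V) (aut_elt Gg)) VE.
have sec (p : aut_orbit) : V (coset_of_orbit p) -> exists (W : set A) (s : A -> 'End(A)),
   [/\ vopen W, W (set_val p), smooth_on W s, (forall x, W x -> U (s x)) &
     forall x : aut_orbit, W (set_val x) -> exists Gs : G (s (set_val x)),
       coset_of_orbit x = proj (aut_elt Gs)].
  move=> Vp; have [W [s [Wo Wp ss sP]]] := aut_orbit_section (set_valP p).
  have sx (x : aut_orbit) : W (set_val x) -> exists Gs : G (s (set_val x)),
       coset_of_orbit x = proj (aut_elt Gs).
    move=> Wx; have [Gs sE] := sP _ Wx; exists Gs; apply: coset_of_orbitE.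
    exact/sE/set_valP.
  exists (W `&` s @^-1` U), s; split.
  - exact: vopen_preimage.
  - split => //; have [Gs E] := sx _ Wp; apply/(VU _ Gs); by rewrite -E.
  - by move=> vs x [Wx _]; exact: ss.
  - by move=> x [].
  - by move=> x [Wx _]; exact: sx.
split.
  (* A single ambient open set is required: the union of all open sets whose trace on the orbit is
     sent into [V] avoids choosing a section at each point. *)
  exists (\bigcup_(W in [set W | vopen W /\
    forall x : aut_orbit, W (set_val x) -> V (coset_of_orbit x)]) W).
    rewrite /vopen preimage_bigcup; apply: bigcup_open => W [+ _]; exact.
  apply/seteqP; split => x.
    move=> Vx; have [W [s [Wo Wx _ sU sC]]] := sec x Vx.
    exists W => //; split => // y Wy; have [Gs ->] := sC y Wy.
    by apply/VU; exact: sU.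
  by move=> [W [_ WV] Wx]; exact: WV.
move=> f sf p Vp; have [W [s [Wo Wp ss sU sC]]] := sec p Vp.
have [Gs E] := sC _ Wp.
have [|W' [F [W'o W's sF fF]]] := sf (aut_elt Gs).
  by rewrite /preimage /= -E.
exists (W `&` s @^-1` W'), (F \o s); split.
- exact: vopen_preimage.
- by split.
- apply: (smooth_on_comp _ W'o _ _ sF); first exact: vopen_preimage.
    by move=> x [].
  by move=> vs x [Wx _]; exact: ss.
- move=> q Vq [Wq W'q]; have [Gsq Eq] := sC _ Wq.
  rewrite /= Eq; apply: (fF (aut_elt Gsq)) => //.
  by rewrite /preimage /= -Eq.
Qed.

Lemma eval_poly_automorphism (P : {poly R}) g : G g ->
  g (eval_poly mul one P alpha) = eval_poly mul one P (g alpha).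
Proof.
move=> Gg; rewrite /eval_poly linear_sum; apply: eq_bigr => k _.
rewrite linearZ; congr (_ *: _); rewrite /power; elim: (nat_of_ord k) => [|m IH] /=.
  exact: automorphisms_one.
by have [_ ->] := Gg; rewrite IH.
Qed.

End Orbit.

Unset Implicit Arguments.

Theorem theorem2p3 (R : realType) (A : vectType R)
    (mul : {bilinear A -> A -> A}) (one : A)
    (hdiv : is_division_algebra mul one) (hpow : power_associative mul)
    (P : {poly R}) (alpha : A)
    (hroot : zero_set mul one P alpha) (hnc : ~ algebra_center mul alpha) :
  exists M : set A,
    [/\ M `<=` zero_set mul one P,
        embedded_submanifold M &
        diffeomorphic
          (homogeneous_space (automorphisms mul) (stabilizer mul alpha))
          (induced_space M)].
Proof.
exists (aut_orbit mul alpha); split.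
- move=> _ [g Gg <-]; rewrite /zero_set /= -(eval_poly_automorphism hdiv) //.
  rewrite (hroot : eval_poly mul one P alpha = 0).
  exact: linear0.
- refine (embedded_aut_orbit hdiv alpha).
exists (@orbit_of_coset _ _ mul alpha), (@coset_of_orbit _ _ mul alpha); split.
- exact: orbit_of_cosetK.
- exact: coset_of_orbitK.
- exact: smooth_orbit_of_coset.
- exact: (smooth_coset_of_orbit hdiv).
Qed.
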